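(* $\mathbf\Omega$ is a strongly inaccessible class-cardinal, not a set cardinal.
   Context: The setting is a class theory of von Neumann–Bernays–Gödel type without the foundation axiom, with von Neumann's axiom that the class of all sets is in bijection with the class $\mathbf{On}$ of all ordinals. It is enriched by new objects called (generalized) skands. A generalized skand of length $\omega^\kappa$ is a system of nested curly braces indexed by the ordinals $\alpha'$ with $0\le\alpha'<\omega^\kappa$. Its $\alpha'$-component is the (possibly empty) set of elements written between the $\alpha'$-th and the $(\alpha'+1)$-th opening brace. Such a skand is regarded as the set whose elements are the elements of its $0$-component together with the skand formed by the braces of index $\ge 1$. It is self-similar if all its components are equal to one and the same set, and it is then an element of itself. Fix an ordinal $\kappa\ge 1$. For ordinals $\alpha\ge 1$ define by transfinite recursion $\mathbf e^{(\alpha)}$ to be the self-similar generalized skand of length $\omega^\kappa$ all of whose components equal $\{\mathbf e^{(\beta)} : 1\le\beta<\alpha\}$. Thus $\mathbf e^{(1)}$ is the empty skand $\{\{\{\dots\}\}\}$, and as a set $\mathbf e^{(\alpha)}=\{\mathbf e^{(\beta)}:1\le\beta\le\alpha\}$. These skands represent the ordinal numbers. Let $\mathbf\Omega_{(0,\omega^\kappa)}$ be the skand-union (componentwise union) of all $\mathbf e^{(\alpha)}$, $\alpha\ge 1$, i.e. the self-similar generalized skand-class all of whose components equal the well-ordered class $\{\mathbf e^{(1)},\mathbf e^{(2)},\dots,\mathbf e^{(\alpha)},\dots\}$. It is a proper class, not a set. For different $\kappa\ge 1$ these skand-classes are isomorphic, so the index is omitted and one writes $\mathbf\Omega$, called the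 last ordinal number or the eschaton. In other words, $\mathbf\Omega$ is the common symbol for the ordinal type of well-ordered proper classes all of whose initial segments are sets. Cardinal numbers are identified with the natural numbers and the initial ordinals. $\mathbf\Omega$ is the initial class-ordinal number, since it is not equinumerous to any smaller ordinal number (every $\alpha<\mathbf\Omega$ is a set), and by definition the cardinality of any proper class is the class-cardinal $\mathbf\Omega$. *)

(* Defs.v *)
From Stdlib Require Export ClassicalEpsilon.

(* A structure for the class theory: its elements are the classes.  [skands] is
   the class of ordered pairs (F, s) where s is the generalized skand whose
   system of components is F. *)
Record class_language := {
  carrier :> Type;
  mem : carrier -> carrier -> Prop;
  skands : carrier
}.

Declare Scope class_scope.
Notation "x \in A" := (mem _ x A) (at level 70, no associativity) : class_scope.
Notation "x \notin A" := (~ mem _ x A) (at level 70, no associativity) : class_scope.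
Local Open Scope class_scope.

(* Formulas of the predicative comprehension schema, with de Bruijn variables:
   [fall] quantifies over sets only, the free variables may denote any class. *)
Inductive formula :=
| fmem (i j : nat)
| feq (i j : nat)
| fneg (f : formula)
| fand (f g : formula)
| fall (f : formula).

Definition scons {X : Type} (x : X) (rho : nat -> X) (n : nat) : X :=
  match n with O => x | S m => rho m end.

Section Notions.

Context {T : class_language}.
Implicit Types (x y z a b c d i k l p s A B C F : T).

Definition is_set x : Prop := exists A, x \in A.

Fixpoint sat (rho : nat -> T) (f : formula) : Prop :=
  match f with
  | fmem i j => rho i \in rho j
  | feq i j => rho i = rho j
  | fneg g => ~ sat rho g
  | fand g h => sat rho g /\ sat rho h
  | fall g => forall x, is_set x -> sat (scons x rho) g
  end.

(* Definite description; the value is meaningful only when exactly one class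
   satisfies [P]. *)
Definition the (P : T -> Prop) : T := epsilon (inhabits (skands T)) P.

(* {x | P x}, x ranging over sets.  No comprehension is assumed here: this has
   the expected elements only when such a class exists in [T]. *)
Definition cls (P : T -> Prop) : T :=
  the (fun A => forall x, x \in A <-> is_set x /\ P x).

Definition empty : T := cls (fun _ => False).
Definition univ : T := cls (fun _ => True).
Definition upair x y : T := cls (fun z => z = x \/ z = y).
Definition opair x y : T := upair (upair x x) (upair x y).
Definition union A : T := cls (fun x => exists y, y \in A /\ x \in y).
Definition subclass A B : Prop := forall x, x \in A -> x \in B.
Definition power A : T := cls (fun x => subclass x A).
Definition succ x : T := cls (fun z => z \in x \/ z = x).

(* The guards [is_set] matter: [opair x y] is a pair with the intended
   components only if x and y are sets. *)
Definition is_fun F : Prop :=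
  (forall p, p \in F -> exists x y, is_set x /\ is_set y /\ p = opair x y) /\
  (forall x y z, is_set x -> is_set y -> is_set z ->
     opair x y \in F -> opair x z \in F -> y = z).
Definition dom F : T := cls (fun x => exists y, is_set y /\ opair x y \in F).
Definition app F x : T := the (fun y => is_set y /\ opair x y \in F).
Definition image F A : T := cls (fun y => exists x, x \in A /\ opair x y \in F).

Definition maps F A B : Prop :=
  is_fun F /\ dom F = A /\ forall x, x \in A -> app F x \in B.
Definition injects F A B : Prop :=
  maps F A B /\
  forall x y, x \in A -> y \in A -> app F x = app F y -> x = y.
Definition bijects F A B : Prop :=
  injects F A B /\ forall y, y \in B -> exists x, x \in A /\ app F x = y.
Definition equinumerous A B : Prop := exists F, bijects F A B.

Definition well_ordered (R : T -> T -> Prop) A : Prop :=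
  (forall x, x \in A -> ~ R x x) /\
  (forall x y z, x \in A -> y \in A -> z \in A -> R x y -> R y z -> R x z) /\
  (forall x y, x \in A -> y \in A -> R x y \/ x = y \/ R y x) /\
  (forall B, subclass B A -> (exists x, x \in B) ->
     exists m, m \in B /\ forall y, y \in B -> m = y \/ R m y).

Definition ordinal a : Prop :=
  is_set a /\ (forall x, x \in a -> subclass x a) /\ well_ordered (mem T) a.
Definition On : T := cls ordinal.

Definition inductive A : Prop :=
  empty \in A /\ forall x, x \in A -> succ x \in A.
Definition omega : T :=
  cls (fun n => forall A, is_set A -> inductive A -> n \in A).

Definition is_limit d : Prop :=
  ordinal d /\ d <> empty /\ forall c, c \in d -> succ c \in d.

(* f is the sequence indexed by the ordinals <= b that starts at a, applies G
   at successor steps and takes suprema at limit steps. *)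
Definition iterates (G : T -> T) a f b : Prop :=
  is_fun f /\ dom f = succ b /\ app f empty = a /\
  (forall d, d \in b -> app f (succ d) = G (app f d)) /\
  (forall d, d \in succ b -> is_limit d ->
     app f d = cls (fun x => exists c, c \in d /\ x \in app f c)).
Definition iter (G : T -> T) a b : T :=
  the (fun y => exists f, iterates G a f b /\ y = app f b).

Definition oadd a b : T := iter succ a b.
Definition omul a b : T := iter (fun x => oadd x a) empty b.
Definition oexp a b : T := iter (fun x => omul x a) (succ empty) b.

(* The system of components of a generalized skand of length omega^k. *)
Definition component_system F : Prop :=
  is_fun F /\ exists k, ordinal k /\ k <> empty /\ dom F = oexp omega k.

(* The system with length l and all components equal to a. *)
Definition const l a : T :=
  cls (fun p => exists i, i \in l /\ p = opair i a).

(* The components of index >= 1, renumbered from 0. *)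
Definition tail F : T :=
  cls (fun p => exists i, i \in dom F /\
                  p = opair i (app F (oadd (succ empty) i))).

Definition skand F : T := app (skands T) F.

End Notions.

(* NBG without foundation, with von Neumann's axiom, and with skands.
   Extensionality holds for all sets, skands included.  It rules out identifying
   arbitrary skands by their components: for distinct skands p, q of length l, the one with 0-component
   {p} and tail q has the same elements as the one with 0-component {q} and
   tail p.  The identity of skands by components is therefore required of
   self-similar skands only ([ax_skand_eq]). *)
Record NBG_skand (T : class_language) : Prop := {
  ax_ext : forall A B : T, (forall x, x \in A <-> x \in B) -> A = B;
  ax_class : forall (f : formula) (rho : nat -> T),
    exists A : T, forall x, x \in A <-> is_set x /\ sat (scons x rho) f;
  ax_pair : forall x y : T, is_set x -> is_set y -> is_set (upair x y);
  ax_union : forall x : T, is_set x -> is_set (union x);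
  ax_power : forall x : T, is_set x -> is_set (power x);
  ax_infinity : exists x : T, is_set x /\ inductive x;
  ax_replacement : forall F x : T, is_fun F -> is_set x -> is_set (image F x);
  ax_von_neumann : equinumerous (@univ T) On;
  ax_skand_fun : is_fun (skands T);
  ax_skand_dom : forall F : T, component_system F -> F \in dom (skands T);
  ax_skand_mem : forall F : T, component_system F ->
    forall x, x \in skand F <-> x \in app F empty \/ x = skand (tail F);
  ax_skand_eq : forall k a b : T, ordinal k -> k <> empty ->
    is_set a -> is_set b ->
    skand (const (oexp omega k) a) = skand (const (oexp omega k) b) -> a = b
}.

Section Eschaton.

Context {T : class_language}.
Implicit Types (x y z a b c i k l p A B C F : T).

(* f is the sequence e^(c), 1 <= c <= a, of self-similar skands of length l. *)
Definition e_sequence l f a : Prop :=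
  is_fun f /\ dom f = cls (fun c => c \in succ a /\ c <> empty) /\
  forall b, b \in dom f ->
    app f b =
    skand (const l (cls (fun x => exists c, c \in b /\ c <> empty /\ x = app f c))).

(* e^(a), for an ordinal a >= 1. *)
Definition e k a : T :=
  the (fun y => exists f, e_sequence (oexp omega k) f a /\ y = app f a).

(* The system of components of e^(a). *)
Definition e_system k a : T :=
  const (oexp omega k)
    (cls (fun x => exists c, c \in a /\ c <> empty /\ x = e k c)).

(* A skand-class is coded by the class of pairs (i, x), x in its i-component,
   since its components may be proper classes. *)
Definition component C i : T := cls (fun x => opair i x \in C).
Definition skand_union (P : T -> Prop) : T :=
  cls (fun p => exists F i x, P F /\ i \in dom F /\ x \in app F i /\ p = opair i x).

Definition Omega k : T :=
  skand_union (fun F => exists a, ordinal a /\ a <> empty /\ F = e_system k a).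

(* The well-ordered class {e^(1), e^(2), ...} of the ordinals below Omega. *)
Definition Omega_numbers k : T := component (Omega k) empty.

(* Every e^(b) is an element of itself, so membership is the weak order. *)
Definition num_lt x y : Prop := x \in y /\ x <> y.

(* In what follows a class A well-ordered by R stands for its ordinal type; the
   smaller ordinals are the types of the segments [seg R A a] with a in A. *)
Definition seg (R : T -> T -> Prop) A a : T := cls (fun x => x \in A /\ R x a).

Definition initial_number (R : T -> T -> Prop) A : Prop :=
  well_ordered R A /\ forall a, a \in A -> ~ equinumerous A (seg R A a).

Definition class_cardinal (R : T -> T -> Prop) A : Prop :=
  initial_number R A /\ ~ is_set A /\ forall a, a \in A -> is_set (seg R A a).

Definition set_cardinal A : Prop := exists x, is_set x /\ equinumerous A x.

Definition smaller_cardinal (R : T -> T -> Prop) A a : Prop :=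
  a \in A /\ initial_number R (seg R A a).

Definition uncountable A : Prop := ~ exists F, injects F A omega.

Definition cofinal (R : T -> T -> Prop) A B : Prop :=
  forall x, x \in A -> exists y, y \in B /\ (x = y \/ R x y).

Definition regular (R : T -> T -> Prop) A : Prop :=
  forall a F, a \in A -> maps F (seg R A a) A ->
    ~ cofinal R A (image F (seg R A a)).

Definition strong_limit (R : T -> T -> Prop) A : Prop :=
  forall a, smaller_cardinal R A a ->
    exists b, smaller_cardinal R A b /\
              equinumerous (power (seg R A a)) (seg R A b).

Definition strongly_inaccessible (R : T -> T -> Prop) A : Prop :=
  uncountable A /\ regular R A /\ strong_limit R A.

End Eschaton.

(* Main.v *)
Require Import Defs.
From Stdlib Require Import ssreflect.

(** The self-similar skand with component [a] is the set [a] with itself added,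
    so e^(b) consists of the e^(c) with 1 <= c <= b, and the elements of Omega
    are ordered like the ordinals >= 1; this order is strict because self-similar
    skands are determined by their components.  If Omega were a set, so would be
    On, and replacement gives regularity: a set of ordinals is bounded.  For the
    strong limit property, the power set of a segment is equinumerous to a set of
    ordinals by von Neumann's axiom; collapsing that set makes it equinumerous to
    a segment of Omega, and the least such segment is an initial number.

    Comprehension is available for formulas only, so every induction and every
    class term has to be shown definable; this includes the iterations behind
    omega^k, needed because the tail of a self-similar skand is the skand itself
    only if [i < omega^k] implies [1 + i < omega^k]. *)
Local Open Scope class_scope.

(** * Definability *)

(** The obstacle is that [the], and with it [app], [iter] and [e], is a choice operator of the
    metalanguage, so a term containing it is not a formula. Such descriptions therefore get
    relational twins built from [opair x y \in F] ([rel_iterates] for [iterates], [pairing] for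
    [bijects]), and a lemma links the two where the arguments are meaningful. Moreover formulas
    quantify over sets only, so class functions enter them as parameters: one function [R] on all
    ordinals for each iteration, and one function [E] on the nonzero ordinals whose value at [a] is
    e^(a). Questions about Omega then become questions about ordinals, transported along [E]. Since
    foundation is absent and every e^(a) contains itself, injectivity of [E] comes from a descent on
    the ordinal indices, not from a rank of skands. Von Neumann's bijection need not carry a set
    onto an initial segment of the ordinals; this is why a collapse follows it. *)

Section Join.

Context {X : Type}.

(** Interleaving leaves infinitely many places for variables and for parameters, so neither kind has
    to be counted when formulas are combined. *)
Fixpoint join (rho sigma : nat -> X) (n : nat) : X :=
  match n with
  | 0 => rho 0
  | 1 => sigma 0
  | S (S m) => join (fun i => rho (S i)) (fun i => sigma (S i)) m
  end.

Fixpoint double (n : nat) : nat :=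
  match n with 0 => 0 | S m => S (S (double m)) end.

Lemma join_double rho sigma n : join rho sigma (double n) = rho n.
Proof.
elim: n rho sigma => [//|n IH] rho sigma.
exact: (IH (fun i => rho (S i)) (fun i => sigma (S i))).
Qed.

Lemma join_Sdouble rho sigma n : join rho sigma (S (double n)) = sigma n.
Proof.
elim: n rho sigma => [//|n IH] rho sigma.
exact: (IH (fun i => rho (S i)) (fun i => sigma (S i))).
Qed.

End Join.

Lemma double_cases n : exists m, n = double m \/ n = S (double m).
Proof.
elim: n => [|n [m [->|->]]]; [exists 0|exists m|exists (S m)]; [by left|by right|by left].
Qed.

Section Renaming.

Context {T : class_language}.

Definition up (xi : nat -> nat) : nat -> nat := scons 0 (fun n => S (xi n)).

Fixpoint rename (xi : nat -> nat) (f : formula) : formula :=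
  match f with
  | fmem i j => fmem (xi i) (xi j)
  | feq i j => feq (xi i) (xi j)
  | fneg g => fneg (rename xi g)
  | fand g h => fand (rename xi g) (rename xi h)
  | fall g => fall (rename (up xi) g)
  end.

Lemma sat_rename f : forall xi (rho sigma : nat -> T),
  (forall n, rho (xi n) = sigma n) -> sat rho (rename xi f) <-> sat sigma f.
Proof.
elim: f => [i j|i j|g IH|g IHg h IHh|g IH] xi rho sigma E /=; rewrite ?E //.
- by rewrite (IH _ _ _ E).
- by rewrite (IHg _ _ _ E) (IHh _ _ _ E).
- have H x : sat (scons x rho) (rename (up xi) g) <-> sat (scons x sigma) g
    by apply: IH => -[|n] /=.
  by split=> A x /A /H.
Qed.

End Renaming.

Section Definability.

Context {T : class_language}.

(* The predicate [P] of a context [c], whose variables have the values [env c],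
   is expressed by one formula; it may use any classes [rho] as parameters.  The
   variables sit at even, the parameters at odd positions. *)
Definition definable {C : Type} (env : C -> nat -> T) (P : C -> Prop) : Prop :=
  exists rho f, forall c, sat (join (env c) rho) f <-> P c.

Definition env1 : T -> nat -> T := fun x _ => x.
Definition extend {C : Type} (env : C -> nat -> T) : C * T -> nat -> T :=
  fun p => scons (snd p) (env (fst p)).

Definition definable1 (P : T -> Prop) := definable env1 P.
Definition definable2 (R : T -> T -> Prop) :=
  definable (extend env1) (fun p => R (fst p) (snd p)).

Lemma set_in (x A : T) : x \in A -> is_set x.
Proof. by exists A. Qed.

Lemma definable_iff C (env : C -> nat -> T) P Q :
  (forall c, P c <-> Q c) -> definable env P -> definable env Q.
Proof.
by move=> E [rho [f H]]; exists rho, f => c; rewrite H.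
Qed.

(* Variables of the old context may become parameters. *)
Lemma definable_weaken C D (env : C -> nat -> T) (env' : D -> nat -> T) P pi xi sigma :
  (forall d n, join (env' d) sigma (xi n) = env (pi d) n) ->
  definable env P -> definable env' (fun d => P (pi d)).
Proof.
move=> E [rho [f H]].
exists (join sigma rho).
(* An old variable goes to position [xi n] of [join (env' d) sigma]: even positions are still
   variables, odd ones refer to [sigma], which now fills the even parameter places. The old
   parameters [rho] move to the odd parameter places. *)
exists (rename (join (fun n => join double (fun i => S (double (double i))) (xi n))
                     (fun n => S (double (S (double n))))) f) => d.
rewrite -H; apply: sat_rename => n.
have [m [->|->]] := double_cases n.
- rewrite !join_double -E.
  by have [i [->|->]] := double_cases (xi m); rewrite !(join_double, join_Sdouble).
- by rewrite !join_Sdouble.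
Qed.

Lemma definable_not C (env : C -> nat -> T) P :
  definable env P -> definable env (fun c => ~ P c).
Proof. by move=> [rho [f H]]; exists rho, (fneg f) => c /=; rewrite H. Qed.

Lemma definable_and C (env : C -> nat -> T) P Q :
  definable env P -> definable env Q -> definable env (fun c => P c /\ Q c).
Proof.
move=> [rho [f Hf]] [sigma [g Hg]].
exists (join rho sigma).
exists (fand (rename (join double (fun n => S (double (double n)))) f)
             (rename (join double (fun n => S (double (S (double n))))) g)) => c /=.
have Ef : sat (join (env c) (join rho sigma))
    (rename (join double (fun n => S (double (double n)))) f)
    <-> P c.
  rewrite -Hf; apply: sat_rename => n.
  by have [m [->|->]] := double_cases n; rewrite !(join_double, join_Sdouble).
have Eg : sat (join (env c) (join rho sigma))
    (rename (join double (fun n => S (double (S (double n))))) g)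
    <-> Q c.
  rewrite -Hg; apply: sat_rename => n.
  by have [m [->|->]] := double_cases n; rewrite !(join_double, join_Sdouble).
by rewrite Ef Eg.
Qed.

Lemma definable_forall C (env : C -> nat -> T) P :
  definable (extend env) (fun p => P (fst p) (snd p)) ->
  definable env (fun c => forall x, is_set x -> P c x).
Proof.
move=> [rho [f H]]; exists rho.
(* Under [fall] the bound variable has index 0 and all positions of [join (env c) rho] move up by
   one, whereas [f] has the bound variable as the first of its even places. The renaming translates
   between the two layouts. *)
exists (fall (rename (join (scons 0 (fun n => S (double n)))
                           (fun n => S (S (double n)))) f)) => c /=.
have K x : sat (scons x (join (env c) rho))
    (rename (join (scons 0 (fun n => S (double n))) (fun n => S (S (double n)))) f) <-> P c x.
  rewrite -(H (c, x)); apply: sat_rename => n.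
  have [[|m] [->|->]] := double_cases n; rewrite ?(join_double, join_Sdouble) //.
    exact: (join_double (env c) rho m).
  exact: (join_Sdouble (env c) rho (S m)).
by split=> A x /A /K.
Qed.

Lemma definable_or C (env : C -> nat -> T) P Q :
  definable env P -> definable env Q -> definable env (fun c => P c \/ Q c).
Proof.
move=> HP HQ; apply: (definable_iff _ _ (fun c => ~ (~ P c /\ ~ Q c))).
  by move=> c; have := classic (P c); have := classic (Q c); tauto.
by apply/definable_not/definable_and; apply: definable_not.
Qed.

Lemma definable_imply C (env : C -> nat -> T) (P Q : C -> Prop) :
  definable env P -> definable env Q -> definable env (fun c => P c -> Q c).
Proof.
move=> HP HQ; apply: (definable_iff _ _ (fun c => ~ (P c /\ ~ Q c))).
  by move=> c; have := classic (P c); have := classic (Q c); tauto.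
by apply/definable_not/definable_and => //; apply: definable_not.
Qed.

Lemma definable_equiv C (env : C -> nat -> T) (P Q : C -> Prop) :
  definable env P -> definable env Q -> definable env (fun c => P c <-> Q c).
Proof. by move=> HP HQ; apply: definable_and; apply: definable_imply. Qed.

Lemma definable_exists C (env : C -> nat -> T) P :
  definable (extend env) (fun p => P (fst p) (snd p)) ->
  definable env (fun c => exists x, is_set x /\ P c x).
Proof.
move=> HP; apply: (definable_iff _ _ (fun c => ~ forall x, is_set x -> ~ P c x)).
  move=> c; split=> [H|[x [sx Px]] H]; last exact: (H x).
  by have [//|N] := classic (exists x, is_set x /\ P c x); case: H => x sx Px; apply: N; exists x.
by apply/definable_not/(definable_forall _ _ (fun c x => ~ P c x))/definable_not.
Qed.

(** A proposition independent of the context, however it is stated, is true or false; a classical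
    case distinction picks a valid or a contradictory formula. *)
Lemma definable_const C (env : C -> nat -> T) (P : Prop) : definable env (fun _ => P).
Proof.
exists (fun _ => skands T).
by have [H|H] := classic P; [exists (feq 0 0)|exists (fneg (feq 0 0))] => c /=; tauto.
Qed.

(** Formulas have no terms, and the value of [t] may be a proper class, over which no quantifier
    ranges. So a term is represented by the membership predicate of its value. *)
Definition definable_term {C : Type} (env : C -> nat -> T) (t : C -> T) : Prop :=
  definable (extend env) (fun p => snd p \in t (fst p)).

Lemma definable_term_extend C (env : C -> nat -> T) t :
  definable_term env t -> definable_term (extend env) (fun p => t (fst p)).
Proof.
apply: (definable_weaken _ _ _ _ _ (fun p : C * T * T => (fst (fst p), snd p))
  (fun n => double (match n with 0 => 0 | S m => S (S m) end)) (fun _ => skands T)).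
by move=> d [|n]; rewrite join_double.
Qed.

Lemma definable_term_var C (env : C -> nat -> T) n : definable_term env (fun c => env c n).
Proof.
exists (fun _ => skands T), (fmem (double 0) (double (S n))) => c.
by rewrite /sat !join_double.
Qed.

Lemma definable_term_const C (env : C -> nat -> T) (a : T) : definable_term env (fun _ => a).
Proof. by exists (fun _ => a), (fmem 0 1) => c. Qed.

(* All classes, not just sets, are compared by their elements; so an atomic
   formula between terms reduces to membership in these terms. *)
Context (HT : NBG_skand T).

Lemma definable_eq C (env : C -> nat -> T) t s :
  definable_term env t -> definable_term env s -> definable env (fun c => t c = s c).
Proof.
move=> Ht Hs.
apply: (definable_iff _ _ (fun c => forall z, is_set z -> (z \in t c <-> z \in s c))).
  move=> c; split=> [H|-> //]; apply: (ax_ext _ HT) => x.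
  by split=> K; apply/(H x) => //; apply: set_in K.
apply: (definable_forall _ _ (fun c z => z \in t c <-> z \in s c)).
exact: definable_equiv.
Qed.

Lemma definable_term_snd C (env : C -> nat -> T) : definable_term (extend env) (fun p => snd p).
Proof. exact: (definable_term_var _ _ 0). Qed.

Lemma definable_mem C (env : C -> nat -> T) t s :
  definable_term env t -> definable_term env s -> definable env (fun c => t c \in s c).
Proof.
move=> Ht Hs.
apply: (definable_iff _ _ (fun c => exists y, is_set y /\ (y = t c /\ y \in s c))).
  by move=> c; split=> [[y [_ [-> //]]]|H]; exists (t c); split=> //; apply: set_in H.
apply: (definable_exists _ _ (fun c y => y = t c /\ y \in s c)).
apply: definable_and => //; apply: definable_eq; first exact: definable_term_snd.
exact: definable_term_extend.
Qed.

Lemma definable_set C (env : C -> nat -> T) t :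
  definable_term env t -> definable env (fun c => is_set (t c)).
Proof.
move=> Ht; apply: (definable_iff _ _ (fun c => exists y, is_set y /\ y = t c)).
  by move=> c; split=> [[y [? <-]]|H] //; exists (t c).
apply: (definable_exists _ _ (fun c y => y = t c)); apply: definable_eq.
  exact: definable_term_snd.
exact: definable_term_extend.
Qed.

Lemma definable_forall_in C (env : C -> nat -> T) (A : C -> T) P :
  definable_term env A -> definable (extend env) (fun p => P (fst p) (snd p)) ->
  definable env (fun c => forall x, x \in A c -> P c x).
Proof.
move=> HA HP; apply: (definable_iff _ _ (fun c => forall x, is_set x -> x \in A c -> P c x)).
  by move=> c; split=> H x => [K|_]; apply: H => //; apply: set_in K.
apply: (definable_forall _ _ (fun c x => x \in A c -> P c x)); exact: definable_imply.
Qed.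

Lemma definable_exists_in C (env : C -> nat -> T) (A : C -> T) P :
  definable_term env A -> definable (extend env) (fun p => P (fst p) (snd p)) ->
  definable env (fun c => exists x, x \in A c /\ P c x).
Proof.
move=> HA HP; apply: (definable_iff _ _ (fun c => exists x, is_set x /\ (x \in A c /\ P c x))).
  move=> c; split=> [[x [_ H]]|[x [K H]]]; exists x => //; split=> //; exact: set_in K.
apply: (definable_exists _ _ (fun c x => x \in A c /\ P c x)); exact: definable_and.
Qed.

Lemma in_cls (P : T -> Prop) : definable1 P -> forall x, x \in cls P <-> is_set x /\ P x.
Proof.
move=> [rho [f H]]; rewrite /cls /the.
apply: (epsilon_spec _ (fun A => forall x, x \in A <-> is_set x /\ P x)).
(* [env1 x] is constantly [x], so all even positions collapse to index 0, and the parameters follow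
   from index 1 on, as in [scons x rho]. *)
have [A HA] := ax_class _ HT (rename (join (fun _ => 0) S) f) rho.
exists A => x; rewrite HA -H (sat_rename f _ _ (join (env1 x) rho)) // => n.
by have [m [->|->]] := double_cases n; rewrite !(join_double, join_Sdouble).
Qed.

Lemma definable_term_cls C (env : C -> nat -> T) P :
  definable (extend env) (fun p => P (fst p) (snd p)) -> definable_term env (fun c => cls (P c)).
Proof.
move=> HP; apply: (definable_iff _ _ (fun p => is_set (snd p) /\ P (fst p) (snd p))).
  move=> [c x] /=; rewrite in_cls //.
  case: HP => rho [f H].
  (* For a fixed [c] its variables turn into parameters; only [y] remains a variable, as [in_cls]
     requires. *)
  exists (join (env c) rho).
  exists (rename (join (scons 0 (fun n => S (double (double n))))
                       (fun n => S (double (S (double n))))) f) => y.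
  rewrite -(H (c, y)); apply: sat_rename => n.
  by have [[|m] [->|->]] := double_cases n;
    rewrite !(join_double, join_Sdouble) //= !(join_double, join_Sdouble).
apply: definable_and => //; apply: definable_set; exact: definable_term_snd.
Qed.

End Definability.

(** Extension point for [definability_step]: redefined with [::=] whenever further operations have
    been shown definable or may be unfolded. *)
Ltac definability_hook := fail.

Ltac definability_var env n :=
  first [ exact (definable_term_var _ env n)
        | lazymatch n with 40 => fail | _ => definability_var env (S n) end ].

(** The order of the patterns matters: a body independent of the context is settled first, and
    guarded quantifiers are tried before the bare implication. The last branch of each match
    eta-expands. *)
Ltac definability_step HT :=
  cbv beta;
  lazymatch goal with
  | |- definable1 ?P => change (definable env1 (fun x => P x))
  | |- definable2 ?P => change (definable (extend env1) (fun p => P (fst p) (snd p)))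
  | |- definable ?env ?P =>
    lazymatch P with
    | (fun _ => ?Q) => apply definable_const
    | (fun _ => _ /\ _) => apply definable_and
    | (fun _ => _ \/ _) => apply definable_or
    | (fun _ => ~ _) => apply definable_not
    | (fun _ => _ <-> _) => apply definable_equiv
    | (fun _ => _ = _) => apply (definable_eq HT)
    | (fun _ => mem _ _ _) => apply (definable_mem HT)
    | (fun _ => is_set _) => apply (definable_set HT)
    | (fun _ => forall x, is_set x -> _) => apply definable_forall
    | (fun _ => forall x, mem _ x _ -> _) => apply definable_forall_in
    | (fun _ => exists x, is_set x /\ _) => apply definable_exists
    | (fun _ => exists x, mem _ x _ /\ _) => apply definable_exists_in
    | (fun _ => _ -> _) => apply definable_imply
    | (fun _ => _) => definability_hook
    | _ => change (definable env (fun c => P c))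
    end
  | |- definable_term ?env ?t =>
    lazymatch t with
    | (fun _ => ?c) => apply definable_term_const
    | (fun x => x) => definability_var env 0
    | (fun p => snd _) => definability_var env 0
    | (fun p => fst _) => definability_var env 0
    | (fun _ => cls _) => apply (definable_term_cls HT)
    | (fun _ => _) => definability_hook
    | _ => change (definable_term env (fun c => t c))
    end
  end.

Ltac definability :=
  match goal with
  | HT : NBG_skand _ |- _ => repeat definability_step HT
  end.

Set Implicit Arguments.
Unset Strict Implicit.

(** * Sets, relations and functions *)

Section Sets.

Context {T : class_language} (HT : NBG_skand T).
Implicit Types (x y z a b d i k l p A B F G : T).

Lemma subclass_eq A B : subclass A B -> subclass B A -> A = B.
Proof. by move=> AB BA; apply: (ax_ext _ HT) => x; split=> [/AB|/BA]. Qed.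

Lemma in_empty x : ~ x \in empty.
Proof. by rewrite /empty (in_cls HT); [definability|case]. Qed.

Lemma empty_set : is_set (@empty T).
Proof. by have [x [_ [/set_in]]] := ax_infinity _ HT. Qed.

Lemma empty_or A : A = empty \/ exists x, x \in A.
Proof.
have [H|H] := classic (exists x, x \in A); [by right|left].
by apply: subclass_eq => x K; [case: H; exists x|case: (in_empty K)].
Qed.

Lemma in_univ x : x \in univ <-> is_set x.
Proof. by rewrite /univ (in_cls HT); [definability|tauto]. Qed.

Lemma in_upair x y z : z \in upair x y <-> is_set z /\ (z = x \/ z = y).
Proof. by apply: (in_cls HT); definability. Qed.

Lemma in_succ x z : z \in succ x <-> is_set z /\ (z \in x \/ z = x).
Proof. by apply: (in_cls HT); definability. Qed.

Lemma in_union A x : x \in union A <-> exists y, y \in A /\ x \in y.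
Proof.
rewrite /union (in_cls HT); first by definability.
by split=> [[]|[y [H K]]] //; split; [apply: set_in K|exists y].
Qed.

Lemma upair_eq_l x y x' y' : is_set x -> upair x y = upair x' y' -> x = x' \/ x = y'.
Proof.
move=> sx E; have /in_upair [_ //] : x \in upair x' y' by rewrite -E in_upair; tauto.
Qed.

Lemma upair_eq_r x y x' y' : is_set y -> upair x y = upair x' y' -> y = x' \/ y = y'.
Proof.
move=> sy E; have /in_upair [_ //] : y \in upair x' y' by rewrite -E in_upair; tauto.
Qed.

Lemma opair_inj x y x' y' : is_set x -> is_set y -> is_set x' -> is_set y' ->
  opair x y = opair x' y' -> x = x' /\ y = y'.
Proof.
move=> sx sy sx' sy' E; have P := ax_pair _ HT.
have Ex : x = x'.
  have [F|F] := upair_eq_l (P _ _ sx sx) E.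
    by have [] := upair_eq_l sx F.
  by have [] := upair_eq_l sx' (eq_sym F).
subst x'; split=> //.
have [F|F] := upair_eq_r (P _ _ sx sy) E.
- have yx : y = x by have [] := upair_eq_r sy F.
  subst y; have [G|G] := upair_eq_r (P _ _ sx sy') (eq_sym E).
    by have [] := upair_eq_r sy' G.
  by have [] := upair_eq_r sy' G.
- have [yx|//] := upair_eq_r sy F.
  by subst y; have [] := upair_eq_r sy' (eq_sym F).
Qed.

Lemma opair_set x y : is_set x -> is_set y -> is_set (opair x y).
Proof. by move=> sx sy; do !apply: (ax_pair _ HT). Qed.

Lemma definable_term_upair C (env : C -> nat -> T) t s :
  definable_term env t -> definable_term env s -> definable_term env (fun c => upair (t c) (s c)).
Proof.
move=> Ht Hs; apply: (definable_iff _ _ (fun q => is_set (snd q) /\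
  (snd q = t (fst q) \/ snd q = s (fst q)))).
  by move=> c; rewrite in_upair.
by definability; apply: definable_term_extend.
Qed.

Lemma definable_term_opair C (env : C -> nat -> T) t s :
  definable_term env t -> definable_term env s -> definable_term env (fun c => opair (t c) (s c)).
Proof. by move=> Ht Hs; do !apply: definable_term_upair. Qed.

Lemma definable_term_succ C (env : C -> nat -> T) t :
  definable_term env t -> definable_term env (fun c => succ (t c)).
Proof.
by move=> Ht; rewrite /succ; definability; apply: definable_term_extend.
Qed.

Ltac definability_sets :=
  lazymatch goal with
  | |- definable_term _ (fun _ => upair _ _) => apply definable_term_upair
  | |- definable_term _ (fun _ => opair _ _) => apply definable_term_opair
  | |- definable_term _ (fun _ => succ _) => apply definable_term_succ
  | |- definable_term _ (fun _ => union _) => unfold union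
  | |- definable_term _ (fun _ => dom _) => unfold dom
  | |- definable_term _ (fun _ => image _ _) => unfold image
  | |- definable_term _ (fun _ => const _ _) => unfold const
  | |- definable _ (fun _ => subclass _ _) => unfold subclass
  | |- definable _ (fun _ => inductive _) => unfold inductive
  | |- definable _ (fun _ => is_limit _) => unfold is_limit
  end.

Ltac definability_hook ::= definability_sets.

Definition relation (R : T -> T -> Prop) : T :=
  cls (fun p => exists x, is_set x /\ exists y, is_set y /\ (p = opair x y /\ R x y)).

Lemma in_relation_pair R : definable2 R -> forall p, p \in relation R <->
  exists x y, is_set x /\ is_set y /\ p = opair x y /\ R x y.
Proof.
move=> HR p; rewrite /relation (in_cls HT).
  definability.
  apply: (definable_weaken _ _ _ _ _ (fun q : T * T * T => (snd (fst q), snd q))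
    (fun n => double (match n with 0 => 0 | S m => 1 end)) (fun _ => skands T) _ HR).
  by move=> d [|n]; rewrite join_double.
split=> [[sp [x [sx [y [sy K]]]]]|[x [y [sx [sy [-> K]]]]]]; first by exists x, y.
split; first exact: opair_set.
by exists x; split=> //; exists y.
Qed.

Lemma in_relation R : definable2 R -> forall x y, is_set x -> is_set y ->
  (opair x y \in relation R <-> R x y).
Proof.
move=> HR x y sx sy; rewrite in_relation_pair //.
split=> [[x' [y' [sx' [sy' [E K]]]]]|K]; last by exists x, y.
by have [-> ->] := opair_inj sx sy sx' sy' E.
Qed.

Lemma relation_fun R : definable2 R ->
  (forall x y z, is_set x -> is_set y -> is_set z -> R x y -> R x z -> y = z) ->
  is_fun (relation R).
Proof.
move=> HR RF; split=> [p /(in_relation_pair HR) [x [y [sx [sy [-> _]]]]]|x y z sx sy sz].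
  by exists x, y.
by rewrite !in_relation //; apply: RF.
Qed.

Lemma in_dom F x : x \in dom F <-> is_set x /\ exists y, is_set y /\ opair x y \in F.
Proof. by rewrite /dom (in_cls HT); first by definability. Qed.

Lemma in_image F A y : y \in image F A <-> is_set y /\ exists x, x \in A /\ opair x y \in F.
Proof. by rewrite /image (in_cls HT); first by definability. Qed.

Lemma dom_pair F x y : is_set x -> is_set y -> opair x y \in F -> x \in dom F.
Proof. by move=> sx sy H; rewrite in_dom; split=> //; exists y. Qed.

Lemma app_spec F x : is_fun F -> x \in dom F -> is_set (app F x) /\ opair x (app F x) \in F.
Proof.
move=> FF /in_dom [sx [y [sy H]]]; rewrite /app /the.
by apply: (epsilon_spec _ (fun y => is_set y /\ opair x y \in F)); exists y.
Qed.

Lemma app_eq F x y : is_fun F -> is_set x -> is_set y -> opair x y \in F -> app F x = y.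
Proof.
move=> FF sx sy H.
have [s K] := app_spec FF (dom_pair sx sy H).
by case: FF => _ FF; apply: (FF x).
Qed.

Lemma fun_ext F G : is_fun F -> is_fun G ->
  (forall x y, is_set x -> is_set y -> (opair x y \in F <-> opair x y \in G)) -> F = G.
Proof.
move=> [FP _] [GP _] E; apply: subclass_eq => p H.
  by have [x [y [sx [sy P]]]] := FP p H; move: H; rewrite P; apply E.
by have [x [y [sx [sy P]]]] := GP p H; move: H; rewrite P; apply E.
Qed.

(** Replacement for the identity restricted to [A]. *)
Lemma separation A x : is_set x -> subclass A x -> is_set A.
Proof.
move=> sx Ax.
have D : definable2 (fun y z => y \in A /\ z = y) by definability.
have F : is_fun (relation (fun y z => y \in A /\ z = y)).
  by apply: relation_fun => // u v w _ _ _ [_ ->] [_ ->].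
have -> : A = image (relation (fun y z => y \in A /\ z = y)) x; last exact: ax_replacement.
apply: (ax_ext _ HT) => z; rewrite in_image; split=> [H|[sz [y [yx]]]].
  have sz := set_in _ _ H; split=> //; exists z.
  by rewrite in_relation //; split=> //; apply: Ax.
have sy := set_in _ _ yx.
by rewrite in_relation // => -[H ->].
Qed.

Definition range F : T := cls (fun y => exists x, is_set x /\ opair x y \in F).

Lemma in_range F y : y \in range F <-> is_set y /\ exists x, is_set x /\ opair x y \in F.
Proof. by rewrite /range (in_cls HT); first by definability. Qed.

Lemma opair_union_r F x y : is_set x -> is_set y -> opair x y \in F -> y \in union (union F).
Proof.
move=> sx sy H; have P := ax_pair _ HT; rewrite in_union; exists (upair x y).
rewrite in_upair in_union; split; last by auto.
by exists (opair x y); rewrite /opair in_upair; auto.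
Qed.

(** By two unions instead of replacement, so that [F] may be an arbitrary set: the step functions of
    the recursions below have to be total on all sets. *)
Lemma range_set F : is_set F -> is_set (range F).
Proof.
move=> sF; apply: (@separation _ (union (union F))); first by do !apply: (ax_union _ HT).
by move=> y /in_range [sy [x [sx H]]]; apply: opair_union_r H.
Qed.

Definition restrict F d : T :=
  cls (fun p => exists x, x \in d /\ exists y, is_set y /\ (p = opair x y /\ opair x y \in F)).

Lemma in_restrict F d p : p \in restrict F d <->
  exists x y, x \in d /\ is_set y /\ p = opair x y /\ opair x y \in F.
Proof.
rewrite /restrict (in_cls HT); first by definability.
split=> [[sp [x [xd [y [sy [-> H]]]]]]|[x [y [xd [sy [-> H]]]]]]; first by exists x, y.
split; first by apply: set_in H.
by exists x; split=> //; exists y.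
Qed.

Lemma opair_restrict F d x y : is_set x -> is_set y ->
  (opair x y \in restrict F d <-> x \in d /\ opair x y \in F).
Proof.
move=> sx sy; rewrite in_restrict; split=> [[x' [y' [xd [sy' [E H]]]]]|[xd H]]; last by exists x, y.
by have [-> ->] := opair_inj sx sy (set_in _ _ xd) sy' E.
Qed.

Lemma restrict_fun F d : is_fun F -> is_fun (restrict F d).
Proof.
move=> [FP FF]; split=> [p /in_restrict [x [y [xd [sy [-> H]]]]]|x y z sx sy sz].
  by exists x, y; split; [apply: set_in xd|].
by rewrite !opair_restrict // => -[_ ?] [_ ?]; apply: (FF x).
Qed.

Lemma dom_restrict F d x : x \in dom (restrict F d) <-> x \in dom F /\ x \in d.
Proof.
rewrite !in_dom; split=> [[sx [y [sy]]]|[[sx [y [sy H]]] xd]].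
  by rewrite opair_restrict // => -[xd H]; do !split=> //; exists y.
by split=> //; exists y; rewrite opair_restrict.
Qed.

Lemma app_restrict F d x : is_fun F -> x \in dom F -> x \in d -> app (restrict F d) x = app F x.
Proof.
move=> FF Fx xd; have [s H] := app_spec FF Fx; have sx := set_in _ _ xd.
by apply: app_eq => //; [exact: restrict_fun|rewrite opair_restrict].
Qed.

(* [F] is the image of its domain under [x |-> (x, F x)]. *)
Lemma fun_set F : is_fun F -> is_set (dom F) -> is_set F.
Proof.
move=> FF sd.
pose R x p := exists y, is_set y /\ (p = opair x y /\ p \in F).
have D : definable2 R by rewrite /R; definability.
have FR : is_fun (relation R).
  apply: relation_fun => // x p q sx _ _ [y [sy [-> H]]] [z [sz [-> K]]].
  by case: FF => _ FF; rewrite (FF x y z).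
apply: separation (ax_replacement _ HT _ _ FR sd) _ => p H.
rewrite in_image; split; first exact: set_in H.
have [x [y [sx [sy E]]]] := proj1 FF p H; rewrite E in H.
exists x; split; first exact: dom_pair H.
rewrite E in_relation //; first exact: set_in H.
by exists y.
Qed.

Lemma restrict_set F d : is_fun F -> is_set d -> is_set (restrict F d).
Proof.
move=> FF sd; apply: fun_set; first exact: restrict_fun.
by apply: separation sd _ => x /dom_restrict [].
Qed.

(** * Ordinals *)

(** The same content with every quantifier directly followed by its guard, the shape that
    [definability] recognizes. *)
Lemma is_funE F :
  ((forall p, p \in F -> exists x, is_set x /\ exists y, is_set y /\ p = opair x y) /\
   (forall x, is_set x -> forall y, is_set y -> forall z, is_set z ->
      opair x y \in F -> opair x z \in F -> y = z)) <-> is_fun F.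
Proof.
split=> -[A B]; split=> [p /A|x].
- by move=> [x [sx [y [sy E]]]]; exists x, y.
- by move=> y z sx sy sz; apply: B.
- by move=> [x [y [sx [sy E]]]]; exists x; split=> //; exists y.
- by move=> sx y sy z sz; apply: B.
Qed.

(** In [well_ordered] the subclass [B] ranges over all classes, which no predicative formula can
    say. As [a] is a set, its subclasses are sets by separation, so a set quantifier suffices. *)
Lemma ordinalE a :
  (is_set a /\ (forall x, x \in a -> forall y, y \in x -> y \in a) /\
   (forall x, x \in a -> ~ x \in x) /\
   (forall x, x \in a -> forall y, y \in a -> forall z, z \in a -> x \in y -> y \in z -> x \in z) /\
   (forall x, x \in a -> forall y, y \in a -> x \in y \/ x = y \/ y \in x) /\
   (forall B, is_set B -> (forall y, y \in B -> y \in a) -> (exists x, x \in B /\ True) ->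
      exists m, m \in B /\ forall y, y \in B -> m = y \/ m \in y)) <-> ordinal a.
Proof.
split.
  move=> [sa [tr [irr [trans [tot wf]]]]]; split=> //; split; first exact: tr.
  split=> //; split; first by move=> x y z xa ya za; apply: trans.
  split; first by move=> x y xa ya; apply: tot.
  move=> B Ba [x xB]; apply: wf => //; first exact: separation Ba.
  by exists x.
move=> [sa [tr [irr [trans [tot wf]]]]]; split=> //; split; first by move=> x xa y yx; apply: tr yx.
split=> //; split; first by move=> x xa y ya z za; apply: trans.
split; first by move=> x xa y ya; apply: tot.
by move=> B sB Ba [x [xB _]]; apply: wf => //; exists x.
Qed.

Ltac definability_ordinals :=
  lazymatch goal with
  | |- definable_term _ (fun _ => range _) => unfold range
  | |- definable_term _ (fun _ => restrict _ _) => unfold restrict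
  | |- definable _ (fun c => is_fun (@?t c)) =>
    apply (definable_iff _ _ _ _ (fun c => is_funE (t c)))
  | |- definable _ (fun c => ordinal (@?t c)) =>
    apply (definable_iff _ _ _ _ (fun c => ordinalE (t c)))
  | _ => definability_sets
  end.

Ltac definability_hook ::= definability_ordinals.

Lemma ordinal_mem a x : ordinal a -> x \in a -> ordinal x.
Proof.
move=> [sa [tr [irr [trans [tot wf]]]]] xa.
have xsub := tr _ xa.
split; first exact: set_in xa.
split; first by move=> y yx z zy; have ya := xsub _ yx; apply: (trans z y x) => //; apply: tr zy.
split; first by move=> y /xsub; apply: irr.
split; first by move=> y z w /xsub ya /xsub za /xsub wa; apply: trans.
split; first by move=> y z /xsub ya /xsub za; apply: tot.
by move=> B Bx; apply: wf => z /Bx /xsub.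
Qed.

Lemma ordinal_trans a x y : ordinal a -> x \in a -> y \in x -> y \in a.
Proof. by move=> [_ [tr _]] xa; apply: tr. Qed.

Lemma ordinal_irr a : ordinal a -> ~ a \in a.
Proof. by move=> [_ [_ [irr _]]] aa; exact: (irr a aa aa). Qed.

Lemma ordinal_sub a b : ordinal a -> ordinal b -> subclass a b -> a = b \/ a \in b.
Proof.
move=> oa ob ab.
have [E|[z]] := empty_or (cls (fun z => z \in b /\ ~ z \in a)).
  left; apply: subclass_eq => // z zb; have [//|za] := classic (z \in a).
  case: (@in_empty z); rewrite -E (in_cls HT); first by definability.
  by split=> //; apply: set_in zb.
have inB y : y \in cls (fun z => z \in b /\ ~ z \in a) <-> y \in b /\ ~ y \in a.
  rewrite (in_cls HT); first by definability.
  by split=> [[]|[yb ya]] //; split=> //; apply: set_in yb.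
move=> zB; right.
have [_ [_ [_ [trans [tot wf]]]]] := ob.
have [m [/inB [mb ma] least]] : exists m, m \in cls (fun z => z \in b /\ ~ z \in a) /\
    forall y, y \in cls (fun z => z \in b /\ ~ z \in a) -> m = y \/ m \in y.
  by apply: wf; [move=> y /inB []|exists z].
suff -> : a = m by [].
apply: subclass_eq => y Hy.
  have yb := ab _ Hy; have [//|[E|my]] := tot y m yb mb; first by rewrite -E in ma.
  by case: ma; apply: ordinal_trans Hy my.
have yb := ordinal_trans ob mb Hy; have [//|ya] := classic (y \in a).
have om := ordinal_mem ob mb.
have [E|my] : m = y \/ m \in y by apply/least/inB.
  by rewrite -E in Hy; case: (ordinal_irr om).
by case: (ordinal_irr om); apply: ordinal_trans Hy my.
Qed.

(** The intersection [d] is an ordinal contained in both; if it were an element of both, it would be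
    an element of itself. *)
Lemma ordinal_total a b : ordinal a -> ordinal b -> a \in b \/ a = b \/ b \in a.
Proof.
move=> oa ob; pose d := cls (fun z => z \in a /\ z \in b).
have ind z : z \in d <-> z \in a /\ z \in b.
  rewrite /d (in_cls HT); first by definability.
  by split=> [[]|[za zb]] //; split=> //; apply: set_in za.
have od : ordinal d.
  have [sa [_ [irr [trans [tot wf]]]]] := oa.
  have da : subclass d a by move=> z /ind [].
  split; first exact: separation sa da.
  split.
    move=> z /ind [za zb] y yz.
    by apply/ind; split; [apply: ordinal_trans za yz|apply: ordinal_trans zb yz].
  split; first by move=> z /da; apply: irr.
  split; first by move=> x y z /da xa /da ya /da za; apply: trans.
  split; first by move=> x y /da xa /da ya; apply: tot.
  by move=> B Bd; apply: wf => z /Bd /da.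
have [E|H] : d = a \/ d \in a by apply: ordinal_sub => // z /ind [].
  have [//|] : a = b \/ a \in b; last by auto.
    by apply: ordinal_sub => // z; rewrite -E => /ind [].
  by auto.
have [E|K] : d = b \/ d \in b by apply: ordinal_sub => // z /ind [].
  by rewrite -E; auto.
by case: (ordinal_irr od); apply/ind.
Qed.

(** [B] may be a proper class, so the minimum is sought among the elements of [B] below a given [x],
    inside the well-ordered set [x]; if there are none, [x] is the minimum. *)
Lemma ordinal_least B : (forall x, x \in B -> ordinal x) -> (exists x, x \in B) ->
  exists m, m \in B /\ forall y, y \in B -> m = y \/ m \in y.
Proof.
move=> oB [x xB]; have ox := oB _ xB.
pose C := cls (fun z => z \in x /\ z \in B).
have inC z : z \in C <-> z \in x /\ z \in B.
  rewrite /C (in_cls HT); first by definability.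
  by split=> [[]|[zx zB]] //; split=> //; apply: set_in zx.
have [E|nC] := empty_or C.
  exists x; split=> // y yB; have [yx|[->|xy]] := ordinal_total (oB _ yB) ox; [|by left|by right].
  by case: (@in_empty y); rewrite -E inC.
have [_ [_ [_ [_ [_ wf]]]]] := ox.
have [m [/inC [mx mB] least]] : exists m, m \in C /\ forall y, y \in C -> m = y \/ m \in y.
  by apply: wf => // z /inC [].
exists m; split=> // y yB; have [yx|[->|xy]] := ordinal_total (oB _ yB) ox.
- by apply/least/inC.
- by right.
- by right; apply: ordinal_trans (oB _ yB) xy mx.
Qed.

Lemma ordinal_intro A : is_set A -> (forall x, x \in A -> ordinal x) ->
  (forall x, x \in A -> subclass x A) -> ordinal A.
Proof.
move=> sA oA tA; split=> //; split=> //; do !split.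
- by move=> x /oA /ordinal_irr.
- by move=> x y z _ _ /oA oz xy yz; apply: ordinal_trans oz yz xy.
- by move=> x y /oA ox /oA oy; apply: ordinal_total.
- by move=> B BA; apply: ordinal_least => x /BA /oA.
Qed.

Lemma in_On x : x \in On <-> ordinal x.
Proof.
rewrite /On (in_cls HT); first by definability.
by split=> [[]|ox] //; split=> //; case: ox.
Qed.

Lemma ordinal_induction (P : T -> Prop) : definable1 P ->
  (forall a, ordinal a -> (forall b, b \in a -> P b) -> P a) -> forall a, ordinal a -> P a.
Proof.
move=> DP H a oa; have [//|Pa] := classic (P a).
pose B := cls (fun x => ordinal x /\ ~ P x).
have inB x : x \in B <-> ordinal x /\ ~ P x.
  rewrite /B (in_cls HT); last by split=> [[]|[ox Px]] //; split=> //; case: ox.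
  by definability.
have [m [/inB [om Pm] least]] : exists m, m \in B /\ forall y, y \in B -> m = y \/ m \in y.
  by apply: ordinal_least; [move=> x /inB []|exists a; apply/inB].
case: Pm; apply: H => // b bm; have [//|Pb] := classic (P b).
have ob := ordinal_mem om bm.
have [E|mb] : m = b \/ m \in b by apply/least/inB.
  by rewrite -E in bm; case: (ordinal_irr om).
by case: (ordinal_irr om); apply: ordinal_trans mb.
Qed.

Lemma ordinal_empty : ordinal (@empty T).
Proof.
by apply: ordinal_intro => [|x /in_empty|x /in_empty]; first exact: empty_set.
Qed.

Lemma succ_set a : is_set a -> is_set (succ a).
Proof.
move=> sa; have P := ax_pair _ HT; apply: (@separation _ (union (upair a (upair a a)))).
  by apply: (ax_union _ HT); auto.
move=> z; rewrite in_succ in_union => -[sz [za|->]].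
  by exists a; rewrite in_upair; auto.
by exists (upair a a); rewrite !in_upair; auto.
Qed.

Lemma mem_succ a : is_set a -> a \in succ a.
Proof. by move=> sa; apply/in_succ; auto. Qed.

Lemma mem_succ_l a x : x \in a -> x \in succ a.
Proof. by move=> xa; apply/in_succ; split; [apply: set_in xa|left]. Qed.

Lemma ordinal_set a : ordinal a -> is_set a.
Proof. by case. Qed.

Hint Resolve ordinal_set empty_set ordinal_empty mem_succ mem_succ_l : core.

Lemma ordinal_succ a : ordinal a -> ordinal (succ a).
Proof.
move=> oa; apply: ordinal_intro; first exact/succ_set/ordinal_set.
  by move=> x /in_succ [_ [xa|->]] //; apply: ordinal_mem xa.
by move=> x /in_succ [_ [xa|->]] y yx; apply: mem_succ_l => //; apply: ordinal_trans yx.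
Qed.

Hint Resolve ordinal_succ : core.

Lemma succ_neq_empty a : is_set a -> succ a <> empty.
Proof. by move=> sa E; apply: (@in_empty a); rewrite -E; apply: mem_succ. Qed.

Lemma ordinal_le a b : ordinal a -> ordinal b -> (subclass a b <-> a \in succ b).
Proof.
move=> oa ob; split=> [H|/in_succ [_ [ab|->]] // x]; last exact: ordinal_trans ab.
by have [->|?] := ordinal_sub oa ob H; auto.
Qed.

Lemma succ_le a b : ordinal b -> a \in b -> succ a \in succ b.
Proof.
move=> ob ab; have oa := ordinal_mem ob ab; apply/ordinal_le; auto.
by move=> x /in_succ [_ [xa|->]] //; apply: ordinal_trans xa.
Qed.

Lemma succ_inj a b : ordinal a -> ordinal b -> succ a = succ b -> a = b.
Proof.
move=> oa ob E.
have /in_succ [_ [ab|//]] : a \in succ b by rewrite -E; auto.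
have /in_succ [_ [ba|//]] : b \in succ a by rewrite E; auto.
by case: (ordinal_irr oa); apply: (ordinal_trans oa ba).
Qed.

Lemma limit_not_succ a : ordinal a -> ~ is_limit (succ a).
Proof. by move=> oa [_ [_ H]]; apply: (@ordinal_irr (succ a)); auto. Qed.

Lemma empty_mem a : ordinal a -> a <> empty -> empty \in a.
Proof.
move=> oa a0; have [//|[E|/in_empty //]] := ordinal_total ordinal_empty oa.
by case: a0.
Qed.

Lemma ordinal_cases a : ordinal a ->
  a = empty \/ (exists b, ordinal b /\ a = succ b) \/ is_limit a.
Proof.
move=> oa; have [|a0] := classic (a = empty); first by left.
right; have [L|NL] := classic (is_limit a); first by right.
left; have [//|N] := classic (exists b, ordinal b /\ a = succ b).
case: NL; split=> //; split=> // b ba; have ob := ordinal_mem oa ba.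
have /in_succ [_ [//|E]] := succ_le oa ba.
by case: N; exists b.
Qed.

Lemma union_ordinal A : is_set A -> (forall x, x \in A -> ordinal x) -> ordinal (union A).
Proof.
move=> sA oA; apply: ordinal_intro; first exact: ax_union.
  by move=> x /in_union [y [/oA oy yx]]; apply: ordinal_mem yx.
move=> x /in_union [y [yA xy]] z zx; apply/in_union; exists y; split=> //.
exact: ordinal_trans (oA _ yA) xy zx.
Qed.

Lemma ordinal_bound A : is_set A -> (forall x, x \in A -> ordinal x) ->
  exists b, ordinal b /\ subclass A b.
Proof.
move=> sA oA; exists (succ (union A)); split; first by apply/ordinal_succ/union_ordinal.
move=> x xA; apply/ordinal_le; [exact: oA|exact: union_ordinal|].
by move=> y yx; apply/in_union; exists x.
Qed.

Lemma in_omega n : n \in omega <-> is_set n /\ forall A, is_set A -> inductive A -> n \in A.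
Proof. by rewrite /omega (in_cls HT); first by definability. Qed.

Lemma omega_set : is_set (@omega T).
Proof.
have [x [sx ix]] := ax_infinity _ HT.
by apply: (separation sx) => n /in_omega [_ H]; apply: H.
Qed.

Lemma omega_inductive : inductive (@omega T).
Proof.
split; first by apply/in_omega; split=> // A _ [].
move=> x /in_omega [sx H]; apply/in_omega; split; first exact: succ_set.
by move=> A sA iA; apply: (proj2 iA); apply: H.
Qed.

Lemma omega_induction (P : T -> Prop) : definable1 P -> P empty ->
  (forall n, n \in omega -> P n -> P (succ n)) -> forall n, n \in omega -> P n.
Proof.
move=> DP P0 PS n no; pose A := cls (fun n => n \in omega /\ P n).
have inA x : x \in A <-> x \in omega /\ P x.
  rewrite /A (in_cls HT); first by definability.
  by split=> [[]|[xo Px]] //; split=> //; apply: set_in xo.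
have [_ H] := proj1 (in_omega n) no.
suff /inA [] : n \in A by [].
apply: H; first by apply: separation omega_set _ => x /inA [].
have [o0 oS] := omega_inductive.
split; first by apply/inA.
by move=> x /inA [xo Px]; apply/inA; auto.
Qed.

Lemma omega_limit : is_limit (@omega T).
Proof.
have [o0 oS] := omega_inductive.
split; last by split=> // E; rewrite E in o0; case: (in_empty o0).
apply: ordinal_intro; first exact: omega_set.
  apply: omega_induction => [||n _]; [by definability|exact: ordinal_empty|exact: ordinal_succ].
apply: omega_induction; first by definability.
  by move=> x /in_empty.
by move=> n no nsub x /in_succ [_ [/nsub|->]].
Qed.

(** * Transfinite recursion *)

Section Recursion.

Variables D P : T.
Hypothesis D_ordinal : forall x, x \in D -> ordinal x.
Hypothesis P_fun : is_fun P.
Hypothesis P_total : forall g, is_set g -> g \in dom P.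

(** A solution of the recursion on the part of [D] below [b], where [P] sends the history of values
    to the next value. [D] is any class of ordinals, not necessarily an initial segment: below it is
    [On], the nonzero ordinals, or a set to be collapsed. *)
Definition attempt f b : Prop :=
  is_fun f /\
  (forall x, is_set x -> (x \in dom f <-> x \in D /\ x \in b)) /\
  (forall x, is_set x -> forall y, is_set y ->
     opair x y \in f -> opair (restrict f x) y \in P).

Definition recursion : T :=
  relation (fun x y => x \in D /\ exists g, is_set g /\ (attempt g x /\ opair g y \in P)).

Lemma attempt_unique b f g : ordinal b -> is_set f -> is_set g ->
  attempt f b -> attempt g b -> f = g.
Proof.
move=> ob sf sg [Ff [df Hf]] [Fg [dg Hg]].
(* One inclusion is enough: [f] and [g] have the same domain and [g] is single-valued, so the
   converse inclusion follows. *)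
have E : forall x, ordinal x -> x \in b -> forall y, is_set y -> opair x y \in f -> opair x y \in g.
  apply: ordinal_induction; first by definability.
  move=> x ox IH xb y sy H; have sx := ordinal_set ox.
  have xD : x \in D by have := dom_pair sx sy H; rewrite df // => -[].
  have xg : x \in dom g by rewrite dg.
  have [sz K] := app_spec Fg xg; set z := app g x in sz K.
  suff -> : y = z by [].
  have := Hg _ sx _ sz K; have := Hf _ sx _ sy H.
  have -> : restrict f x = restrict g x; last first.
    have srg : is_set (restrict g x) by apply: restrict_set.
    by case: P_fun => _ PF; apply: PF.
  apply: fun_ext; [exact: restrict_fun|exact: restrict_fun|].
  move=> u v su sv; rewrite !opair_restrict //; split=> -[ux L]; split=> //.
    by apply: IH => //; apply: ordinal_trans xb ux.
  have ub : u \in b by apply: ordinal_trans xb ux.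
  have uD : u \in D by have := dom_pair su sv L; rewrite dg // => -[].
  have uf : u \in dom f by rewrite df.
  have [sw M] := app_spec Ff uf.
  have N := IH _ ux ub _ sw M.
  by case: Fg => _ Fg; rewrite (Fg u v (app f u)).
apply: fun_ext => // x y sx sy; split=> H.
  have := dom_pair sx sy H; rewrite df // => -[xD xb]; apply: E => //; exact: D_ordinal.
have := dom_pair sx sy H; rewrite dg // => -[xD xb].
have xf : x \in dom f by rewrite df.
have [sz K] := app_spec Ff xf.
have L := E _ (D_ordinal xD) xb _ sz K.
by case: Fg => _ Fg; rewrite (Fg x y (app f x)).
Qed.

Lemma recursion_definable :
  definable2 (fun x y => x \in D /\ exists g, is_set g /\ (attempt g x /\ opair g y \in P)).
Proof. by rewrite /attempt; definability. Qed.

Lemma in_recursion x y : is_set x -> is_set y -> (opair x y \in recursion <->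
  x \in D /\ exists g, is_set g /\ (attempt g x /\ opair g y \in P)).
Proof. by move=> sx sy; rewrite /recursion in_relation //; exact: recursion_definable. Qed.

Lemma recursion_fun : is_fun recursion.
Proof.
apply: relation_fun; first exact: recursion_definable.
move=> x y z sx sy sz [xD [g [sg [Hg gy]]]] [_ [h [sh [Hh hz]]]].
have E : g = h by apply: (attempt_unique (D_ordinal xD)).
by rewrite E in gy; case: P_fun => _ PF; apply: (PF h).
Qed.

Lemma recursion_attempt : forall b, ordinal b -> attempt (restrict recursion b) b.
Proof.
apply: ordinal_induction.
  by rewrite /attempt; definability.
move=> b ob IH.
have dR x : x \in b -> x \in D -> x \in dom recursion.
  move=> xb xD; have sx := set_in _ _ xb; have ox := D_ordinal xD.
  have sR : is_set (restrict recursion x) by apply: restrict_set => //; exact: recursion_fun.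
  have [sy K] := app_spec P_fun (P_total sR).
  apply: (dom_pair sx sy); rewrite in_recursion //.
  by split=> //; exists (restrict recursion x); split=> //; split=> //; apply: IH.
split; first exact/restrict_fun/recursion_fun.
split=> x sx.
  rewrite dom_restrict; split=> [[/in_dom [_ [y [sy H]]] xb]|[xD xb]]; last by auto.
  by move: H; rewrite in_recursion // => -[].
move=> y sy; rewrite opair_restrict // => -[xb].
rewrite in_recursion //.
move=> [xD [g [sg [Hg gy]]]]; have ox := D_ordinal xD.
have -> : restrict (restrict recursion b) x = restrict recursion x.
  apply: fun_ext; [exact/restrict_fun/restrict_fun/recursion_fun|exact/restrict_fun/recursion_fun|].
  move=> u v su sv; rewrite !opair_restrict //.
  by split=> [[ux [_ H]]|[ux H]] //; do !split=> //; apply: ordinal_trans xb ux.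
suff -> : restrict recursion x = g by [].
apply: (attempt_unique ox) => //; last by apply: IH.
by apply: restrict_set => //; exact: recursion_fun.
Qed.

Lemma recursion_dom : dom recursion = D.
Proof.
apply: subclass_eq => x.
  rewrite in_dom => -[sx [y [sy]]]; by rewrite in_recursion // => -[].
move=> xD; have ox := D_ordinal xD; have os := ordinal_succ ox.
have [_ [H _]] := recursion_attempt os.
have : x \in dom (restrict recursion (succ x)) by rewrite H; auto.
by rewrite dom_restrict => -[].
Qed.

Lemma recursion_step x : x \in D -> opair (restrict recursion x) (app recursion x) \in P.
Proof.
(* An attempt at [x] says nothing about the value at [x], hence the attempt at [succ x]. *)
move=> xD; have ox := D_ordinal xD; have os := ordinal_succ ox.
have [_ [_ H]] := recursion_attempt os.
have FR := recursion_fun.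
have xR : x \in dom recursion by rewrite recursion_dom.
have [sy K] := app_spec FR xR.
have E : restrict (restrict recursion (succ x)) x = restrict recursion x.
  apply: fun_ext; [exact/restrict_fun/restrict_fun|exact/restrict_fun|].
  move=> u v su sv; rewrite !opair_restrict //.
  by split=> [[ux [_ L]]|[ux L]] //; do !split=> //; auto.
rewrite -E; apply: H; auto.
by rewrite opair_restrict; auto.
Qed.

End Recursion.

Theorem transfinite_recursion D P :
  (forall x, x \in D -> ordinal x) -> is_fun P -> (forall g, is_set g -> g \in dom P) ->
  exists R, is_fun R /\ dom R = D /\ forall x, x \in D -> opair (restrict R x) (app R x) \in P.
Proof.
move=> HD FP TP; exists (recursion D P).
split; first exact: recursion_fun.
by split; [exact: recursion_dom|exact: recursion_step].
Qed.

(** * Iteration and ordinal arithmetic *)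

Lemma union_range_restrict F d x : x \in union (range (restrict F d)) <->
  exists z, z \in d /\ exists y, is_set y /\ (opair z y \in F /\ x \in y).
Proof.
rewrite in_union; split.
  move=> [y [/in_range [sy [z [sz]]]]]; rewrite opair_restrict // => -[zd zy] xy.
  by exists z; split=> //; exists y.
move=> [z [zd [y [sy [zy xy]]]]]; exists y; split=> //; rewrite in_range; split=> //.
have sz := set_in _ _ zd.
by exists z; rewrite opair_restrict.
Qed.

Lemma union_range_restrict_app F d x : is_fun F -> subclass d (dom F) ->
  (x \in union (range (restrict F d)) <-> exists z, z \in d /\ x \in app F z).
Proof.
move=> FF dF; rewrite union_range_restrict; split=> -[z [zd]].
  move=> [y [sy [zy xy]]]; exists z; split=> //.
  by rewrite (app_eq FF _ sy zy) //; apply: set_in zd.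
move=> xz; exists z; split=> //; exists (app F z).
by have [s K] := app_spec FF (dF _ zd).
Qed.

(** The class on the left is described with [app]; its elements are known only once the description
    has been replaced by the definable right-hand side. *)
Lemma sup_eq F d : is_fun F -> subclass d (dom F) ->
  cls (fun x => exists z, z \in d /\ x \in app F z) = union (range (restrict F d)).
Proof.
move=> FF dF; apply: (ax_ext _ HT) => x.
rewrite (in_cls HT); last first.
  rewrite union_range_restrict_app //.
  by split=> [[]|[z [zd K]]] //; split; [apply: set_in K|exists z].
apply: (definable_iff _ _ (fun x => x \in union (range (restrict F d)))).
  by move=> y; apply: union_range_restrict_app.
by definability.
Qed.

(** A single class function in place of the sequences [iterates G a f b] for all [b]; its
    restriction to [succ b] is such a sequence. *)
Definition progression (G : T -> T) a R : Prop :=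
  is_fun R /\ dom R = On /\ app R empty = a /\
  (forall d, ordinal d -> ordinal (app R d)) /\
  (forall d, ordinal d -> app R (succ d) = G (app R d)) /\
  (forall d, is_limit d -> app R d = union (range (restrict R d))).

(* The condition [iterates G a f b], with G replaced by a relation so that it
   can be expressed by a formula. *)
Definition rel_iterates (S : T -> T -> Prop) a f b : Prop :=
  is_fun f /\ dom f = succ b /\ opair empty a \in f /\
  (forall d, d \in b -> forall x, is_set x -> forall y, is_set y ->
     opair d x \in f -> opair (succ d) y \in f -> S x y) /\
  (forall d, d \in succ b -> is_limit d ->
     forall y, is_set y -> opair d y \in f -> y = union (range (restrict f d))).

Section Iteration.

Variables (G : T -> T) (S : T -> T -> Prop) (a : T).
Hypothesis G_ordinal : forall x, ordinal x -> ordinal (G x).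
Hypothesis S_definable : definable2 S.
Hypothesis S_graph : forall x y, ordinal x -> is_set y -> (S x y <-> y = G x).
Hypothesis a_ordinal : ordinal a.

(** Cut down to ordinals because [S] is known to describe [G] only there. *)
Let H := relation (fun x y => ordinal x /\ S x y).

Lemma graph_definable : definable2 (fun x y => ordinal x /\ S x y).
Proof. by apply: definable_and => //; definability. Qed.

Lemma in_graph x y : is_set x -> is_set y -> (opair x y \in H <-> ordinal x /\ y = G x).
Proof.
move=> sx sy; rewrite /H in_relation //; first exact: graph_definable.
by split=> -[ox]; [rewrite S_graph|rewrite -S_graph].
Qed.

Let succ_step g y : Prop :=
  exists d, is_set d /\ (ordinal d /\ dom g = succ d /\
    exists x, is_set x /\ (is_fun g /\ opair d x \in g /\ opair x y \in H)).

(** The negated conditions make the cases exclusive, so the relation is single-valued. The last case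
    is the limit step and also the default for sets [g] that are no histories, which gives
    totality. *)
Let step g y : Prop :=
  (dom g = empty /\ y = a) \/
  (dom g <> empty /\ succ_step g y) \/
  (dom g <> empty /\ ~ (exists z, is_set z /\ succ_step g z) /\ y = union (range g)).

Lemma succ_step_unique g y z : is_set y -> is_set z -> succ_step g y -> succ_step g z -> y = z.
Proof.
move=> sy sz [d [sd [od [E [x [sx [[_ Fg] [dx xy]]]]]]]]
  [d' [sd' [od' [E' [x' [sx' [_ [dx' xz]]]]]]]].
have F : d = d' by apply: succ_inj; rewrite -?E.
subst d'; move: xz xy; rewrite (Fg d x' x) // !in_graph //.
by move=> [_ ->] [_ ->].
Qed.

Lemma progression_exists : exists R, progression G a R.
Proof.
have Dstep : definable2 step by rewrite /step /succ_step; definability.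
have [R [FR [dR HR]]] : exists R, is_fun R /\ dom R = On /\
    forall x, x \in On -> opair (restrict R x) (app R x) \in relation step.
  apply: transfinite_recursion; first by move=> x; rewrite in_On.
    apply: relation_fun => // g y z sg sy sz.
    move=> [[E ->]|[[N A]|[N [A ->]]]] [[E' ->]|[[N' A']|[N' [A' ->]]]] //.
        exact: succ_step_unique A A'.
      by case: A'; exists y.
    by case: A; exists z.
  move=> g sg.
  have [y [sy K]] : exists y, is_set y /\ step g y.
    have [E|N] := classic (dom g = empty); first by exists a; split; [auto|left].
    have [[y [sy K]]|A] := classic (exists z, is_set z /\ succ_step g z).
      by exists y; split=> //; right; left.
    exists (union (range g)); split; first exact/(ax_union _ HT)/range_set.
    by right; right.
  by apply: (dom_pair sg sy); rewrite in_relation.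
have mR x : ordinal x -> x \in dom R by rewrite dR in_On.
have sR x : ordinal x -> is_set (app R x) by move=> ox; case: (app_spec FR (mR _ ox)).
have pR x : ordinal x -> opair x (app R x) \in R.
  by move=> ox; case: (app_spec FR (mR _ ox)).
have {}HR x : ordinal x -> step (restrict R x) (app R x).
  move=> ox; have := HR x; rewrite in_On in_relation //; auto.
  by apply: restrict_set; auto.
have domr x : ordinal x -> dom (restrict R x) = x.
  move=> ox; apply: subclass_eq => z; rewrite dom_restrict; first by case.
  by move=> zx; split=> //; apply/mR/ordinal_mem/zx.
have R0 : app R empty = a.
  by case: (HR empty) => // [[_ ->]|[[[]]|[[]]]] //; apply: domr.
have RS d : ordinal d -> ordinal (app R d) -> app R (succ d) = G (app R d).
  move=> od oRd; have os := ordinal_succ od.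
  have sd := ordinal_set od.
  have N : dom (restrict R (succ d)) <> empty by rewrite domr //; apply: succ_neq_empty.
  have A : succ_step (restrict R (succ d)) (G (app R d)).
    exists d; split=> //; split=> //; split; first exact: domr.
    exists (app R d); split; first exact: sR.
    split; first exact: restrict_fun.
    by rewrite opair_restrict ?in_graph; auto 6.
  have sG := ordinal_set (G_ordinal oRd).
  case: (HR (succ d)) => // [[]|[[_ B]|[_ [B _]]]] //.
    by apply: succ_step_unique B A; auto.
  by case: B; exists (G (app R d)).
have RL d : is_limit d -> app R d = union (range (restrict R d)).
  move=> Ld; have [od [d0 _]] := Ld.
  case: (HR d) => // [[E]|[[_ [e [se [oe [E _]]]]]|[_ [_ //]]]].
    by move: E; rewrite domr.
  by move: Ld; rewrite -(domr d) // E => /limit_not_succ.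
(* Stated for pairs in [R] because the induction needs a formula; [C] then returns to [app R d]. *)
have Rord : forall d, ordinal d -> forall y, is_set y -> opair d y \in R -> ordinal y.
  apply: ordinal_induction; first by definability.
  have C y d : is_set y -> ordinal d -> opair d y \in R -> y = app R d.
    by move=> sy od K; rewrite (@app_eq R d y); auto.
  move=> d od IH y sy /(C _ _ sy od) ->.
  have {}IH e : e \in d -> ordinal (app R e).
    by move=> ed; have oe := ordinal_mem od ed; apply: (IH e); auto.
  have [E|[[e [oe E]]|L]] := ordinal_cases od.
      by rewrite E R0.
    have oRe : ordinal (app R e) by apply: IH; rewrite E; auto.
    by rewrite E RS; auto.
  rewrite RL //; apply: union_ordinal; first by apply/range_set/restrict_set; auto.
  move=> x /in_range [sx [z [sz]]]; rewrite opair_restrict // => -[zd].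
  by move=> /(C _ _ sx (ordinal_mem od zd)) ->; apply: IH.
exists R; split=> //; split=> //; split=> //; split; first by move=> d od; apply: (Rord d); auto.
by split=> // d od; apply: RS => //; apply: (Rord d); auto.
Qed.

Variable R : T.
Hypothesis HR : progression G a R.

Lemma progression_mem d : ordinal d -> d \in dom R.
Proof. by case: HR => _ [-> _]; rewrite in_On. Qed.

Lemma progression_pair d : ordinal d -> is_set (app R d) /\ opair d (app R d) \in R.
Proof. by move=> od; apply: app_spec; [case: HR|exact: progression_mem]. Qed.

Lemma progression_limit d x : is_limit d -> (x \in app R d <-> exists z, z \in d /\ x \in app R z).
Proof.
move=> L; have [FR [dR [_ [_ [_ RL]]]]] := HR; rewrite RL //.
apply: union_range_restrict_app => // z zd; rewrite dR in_On.
by apply: ordinal_mem zd; case: L.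
Qed.

(** The successor clause may assume that the value is an ordinal. This weaker requirement covers
    [rel_iterates] as well as [iterates], since [S] is the graph of [G] on ordinals only. *)
Lemma progression_agree b f : ordinal b -> is_fun f -> dom f = succ b -> app f empty = a ->
  (forall d, d \in b -> ordinal (app f d) -> app f (succ d) = G (app f d)) ->
  (forall d, d \in succ b -> is_limit d -> app f d = union (range (restrict f d))) ->
  forall d, d \in succ b -> app f d = app R d.
Proof.
move=> ob Ff df f0 fS fL d db.
have [FR [dR [R0 [Ro [RS RL]]]]] := HR.
have osb := ordinal_succ ob.
suff E : forall d, ordinal d -> d \in succ b -> exists y, is_set y /\
    (opair d y \in R /\ opair d y \in f).
  have od := ordinal_mem osb db.
  have [y [sy [dy dy']]] := E d od db.
  by rewrite (app_eq FR _ sy dy) ?(app_eq Ff _ sy dy'); auto.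
apply: ordinal_induction; first by definability.
move=> {db}d od IH db.
have {}IH e : e \in d -> app f e = app R e.
  move=> ed; have [y [sy [ey ey']]] := IH e ed (ordinal_trans osb db ed).
  have oe := ordinal_mem od ed.
  by rewrite (app_eq FR _ sy ey) ?(app_eq Ff _ sy ey'); auto.
suff E : app f d = app R d.
  exists (app R d); have [s K] := progression_pair od; split=> //; split=> //.
  by rewrite -E; apply: (proj2 (app_spec Ff _)); rewrite df.
have [E|[[e [oe E]]|L]] := ordinal_cases od.
- by rewrite E f0 R0.
- subst d; have eb : e \in b.
    have /in_succ [_ [K|K]] := db; first by apply: ordinal_trans K _; auto.
    by rewrite -K; auto.
  have F : app f e = app R e by apply: IH; auto.
  by rewrite fS ?RS ?F; auto.
- rewrite RL // fL //; apply: (ax_ext _ HT) => x.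
  have df' : subclass d (dom f) by rewrite df => z zd; apply: ordinal_trans db zd.
  have dR' : subclass d (dom R) by rewrite dR => z zd; rewrite in_On; apply: ordinal_mem zd.
  rewrite !union_range_restrict_app //.
  by split=> -[z [zd K]]; exists z; split=> //; [rewrite -IH|rewrite IH].
Qed.

Lemma progression_restrict b : ordinal b ->
  is_fun (restrict R (succ b)) /\ dom (restrict R (succ b)) = succ b /\
  (forall d, d \in succ b -> app (restrict R (succ b)) d = app R d) /\
  (forall d, d \in succ b -> is_limit d ->
    union (range (restrict (restrict R (succ b)) d)) = app R d).
Proof.
move=> ob; have [FR [dR [R0 [Ro [RS RL]]]]] := HR; have osb := ordinal_succ ob.
have bR d : d \in succ b -> d \in dom R by move=> db; apply/progression_mem/ordinal_mem/db.
split; first exact: restrict_fun.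
split.
  apply: subclass_eq => z; rewrite dom_restrict; first by case.
  by auto.
split; first by move=> d db; apply: app_restrict; auto.
move=> d db L; rewrite RL //; apply: (ax_ext _ HT) => x.
rewrite !union_range_restrict; split=> -[z [zd [y [sy [zy xy]]]]]; exists z; split=> //; exists y.
  by move: zy; rewrite opair_restrict //; [apply: set_in zd|case].
by rewrite opair_restrict //; [apply: set_in zd|do !split=> //; apply: ordinal_trans db zd].
Qed.

Lemma iter_progression b : ordinal b -> iter G a b = app R b.
Proof.
move=> ob; have [FR [dR [R0 [Ro [RS RL]]]]] := HR; have osb := ordinal_succ ob.
have bsb : b \in succ b by auto.
have : exists f, iterates G a f b /\ iter G a b = app f b.
  rewrite /iter /the; apply: (epsilon_spec _ (fun y => exists f, iterates G a f b /\ y = app f b)).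
  have [Fr [dr [Er Lr]]] := progression_restrict ob.
  exists (app R b), (restrict R (succ b)); split; last by rewrite Er.
  split=> //; split=> //; split.
    rewrite Er //; have [->|b0] := classic (b = empty); auto.
    by apply/mem_succ_l/empty_mem.
  split.
    move=> d db; have od := ordinal_mem ob db; have sdb := succ_le ob db.
    by rewrite (Er _ sdb) (Er _ (mem_succ_l db)) RS.
  move=> d db L; rewrite Er // sup_eq ?Lr // dr => z zd; exact: ordinal_trans db zd.
move=> [f [[Ff [df [f0 [fS fL]]]] ->]]; apply: (progression_agree ob Ff df) => //.
  by move=> d db _; apply: fS.
move=> d db L; rewrite fL // sup_eq // df => z zd; exact: ordinal_trans db zd.
Qed.

(** A formula with set quantifiers for the graph of an iteration. It lets the result serve as the
    step of the next iteration: addition for multiplication, multiplication for powers. *)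
Lemma rel_iterates_iter b y : ordinal b -> is_set y ->
  ((exists f, is_set f /\ (rel_iterates S a f b /\ opair b y \in f)) <-> y = iter G a b).
Proof.
move=> ob sy; have [FR [dR [R0 [Ro [RS RL]]]]] := HR; have osb := ordinal_succ ob.
have bsb : b \in succ b by auto.
have zsb : empty \in succ b.
  by have [->|b0] := classic (b = empty); [|apply: mem_succ_l; apply: empty_mem]; auto.
rewrite iter_progression //; split.
  move=> [f [sf [[Ff [df [f0 [fS fL]]]] byf]]].
  have pf d : d \in succ b -> is_set (app f d) /\ opair d (app f d) \in f.
    by move=> db; apply: app_spec; rewrite ?df.
  rewrite -(app_eq Ff _ sy byf); auto; apply: (progression_agree ob Ff df) => //.
      by apply: app_eq => //; auto.
    move=> d db od; have [s K] := pf d (mem_succ_l db).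
    have [s' K'] := pf _ (succ_le ob db).
    by apply/S_graph => //; apply: (fS d).
  by move=> d db L; have [s K] := pf d db; apply: fL.
move=> ->; have [Fr [dr [Er Lr]]] := progression_restrict ob.
have inr d z : is_set z -> d \in succ b -> opair d z \in restrict R (succ b) -> z = app R d.
  by move=> sz db K; rewrite -(Er d) // (app_eq Fr _ sz K) //; apply: set_in db.
have pr d : d \in succ b -> opair d (app R d) \in restrict R (succ b).
  move=> db; have [s K] := progression_pair (ordinal_mem osb db).
  by rewrite opair_restrict //; apply: set_in db.
exists (restrict R (succ b)); split; first by apply: restrict_set; auto.
split; last exact: pr.
split=> //; split=> //; split; first by rewrite -R0; apply: pr.
split.
  move=> d db x sx z sz; have od := ordinal_mem ob db.
  move=> /(inr _ _ sx (mem_succ_l db)) -> /(inr _ _ sz (succ_le ob db)) ->.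
  by rewrite RS // S_graph //; auto; apply/ordinal_set/G_ordinal; auto.
by move=> d db L z sz /(inr _ _ sz db) ->; rewrite Lr.
Qed.

End Iteration.

(** * Ordinal sums, products and powers of omega *)

Definition add_graph a b y : Prop :=
  exists f, is_set f /\ (rel_iterates (fun x z => z = succ x) a f b /\ opair b y \in f).

Definition mul_graph a b y : Prop :=
  exists f, is_set f /\ (rel_iterates (fun x z => add_graph x a z) empty f b /\ opair b y \in f).

Ltac definability_hook ::=
  lazymatch goal with
  | |- definable _ (fun _ => rel_iterates _ _ _ _) => unfold rel_iterates
  | |- definable _ (fun _ => add_graph _ _ _) => unfold add_graph
  | |- definable _ (fun _ => mul_graph _ _ _) => unfold mul_graph
  | _ => definability_ordinals
  end.

(** [P] takes the value as a second argument, so that its definability can be checked without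
    [app]. *)
Lemma progression_induction (G : T -> T) a R (P : T -> T -> Prop) :
  progression G a R -> definable2 P -> P empty a ->
  (forall d, ordinal d -> P d (app R d) -> P (succ d) (G (app R d))) ->
  (forall d, is_limit d -> (forall z, z \in d -> P z (app R z)) -> P d (app R d)) ->
  forall d, ordinal d -> P d (app R d).
Proof.
move=> HR DP P0 PS PL d od; have [FR [_ [R0 [_ [RS _]]]]] := HR.
have E : forall d, ordinal d -> exists y, is_set y /\ (opair d y \in R /\ P d y).
  apply: ordinal_induction.
    apply: definable_exists; apply: definable_and; first by definability.
    apply: (definable_weaken _ _ _ _ _ (fun q : T * T => q) double (fun _ => skands T) _ DP).
    by move=> q n; rewrite join_double.
  move=> {od}d od IH; exists (app R d); have [s K] := progression_pair HR od.
  split=> //; split=> //.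
  have {}IH z : z \in d -> P z (app R z).
    move=> zd; have [y [sy [zy Py]]] := IH z zd.
    by rewrite (app_eq FR _ sy zy) //; apply: set_in zd.
  have [->|[[e [oe E]]|L]] := ordinal_cases od; last exact: PL.
    by rewrite R0.
  by subst d; rewrite RS //; apply: PS => //; apply: IH; auto.
by have [y [sy [dy Py]]] := E d od; rewrite (app_eq FR _ sy dy); auto.
Qed.

Lemma oadd_progression a : ordinal a ->
  exists R, progression succ a R /\ forall b, ordinal b -> oadd a b = app R b.
Proof.
move=> oa.
have D : definable2 (fun x z : T => z = succ x) by definability.
have E (x z : T) : ordinal x -> is_set z -> (z = succ x <-> z = succ x) by [].
have [R HR] := progression_exists (@ordinal_succ) D E oa.
exists R; split=> // b ob; exact: (iter_progression HR ob).
Qed.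

Lemma oadd_graph a b y : ordinal a -> ordinal b -> is_set y -> (add_graph a b y <-> y = oadd a b).
Proof.
move=> oa ob sy.
have D : definable2 (fun x z : T => z = succ x) by definability.
have E (x z : T) : ordinal x -> is_set z -> (z = succ x <-> z = succ x) by [].
have [R HR] := progression_exists (@ordinal_succ) D E oa.
exact: (rel_iterates_iter (@ordinal_succ) E oa HR ob sy).
Qed.

Lemma oadd_ordinal a b : ordinal a -> ordinal b -> ordinal (oadd a b).
Proof.
move=> oa ob; have [R [[_ [_ [_ [oR _]]]] E]] := oadd_progression oa.
by rewrite E //; apply: oR.
Qed.

Lemma mem_oadd a b : ordinal a -> ordinal b -> b <> empty -> a \in oadd a b.
Proof.
move=> oa ob b0; have [R [HR ->]] := oadd_progression oa => //.
have [FR [_ [R0 [oR [RS _]]]]] := HR.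
move: b0; apply: (progression_induction (P := fun b y : T => b <> empty -> a \in y) HR) => //.
  by definability.
  move=> d od IH _; have [->|d0] := classic (d = empty); first by rewrite R0; auto.
  by apply/mem_succ_l/IH.
move=> d L IH _; have [od [d0 H]] := L.
have zd := H _ (empty_mem od d0).
rewrite (progression_limit HR) //; exists (succ empty); split=> //.
by apply: IH => //; apply: succ_neq_empty.
Qed.

(** [1 + i] is [i + 1] for finite [i] and [i] otherwise; the common bound avoids the distinction and
    suffices below a limit ordinal. *)
Lemma one_oadd_le i : ordinal i -> subclass (oadd (succ (@empty T)) i) (succ i).
Proof.
move=> oi; have [R [HR ->]] := oadd_progression (ordinal_succ ordinal_empty) => //.
have [FR [_ [R0 [oR [RS _]]]]] := HR.
apply: (progression_induction (P := fun b y : T => subclass y (succ b)) HR) => //.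
- by definability.
- move=> d od /ordinal_le IH.
  by apply/ordinal_le; auto; apply: succ_le; auto; apply: IH; auto.
- move=> d L IH x; rewrite (progression_limit HR) // => -[z [zd /(IH _ zd)]].
  have [od [d0 H]] := L; move=> xz; apply: mem_succ_l.
  by apply: ordinal_trans xz; auto.
Qed.

Lemma omul_progression a : ordinal a ->
  exists R, progression (fun x => oadd x a) empty R /\ forall b, ordinal b -> omul a b = app R b.
Proof.
move=> oa.
have D : definable2 (fun x z : T => add_graph x a z) by definability.
have E (x z : T) : ordinal x -> is_set z -> (add_graph x a z <-> z = oadd x a).
  by move=> ox sz; apply: oadd_graph.
have O x : ordinal x -> ordinal (oadd x a) by move=> ox; apply: oadd_ordinal.
have [R HR] := progression_exists O D E ordinal_empty.
exists R; split=> // b ob; exact: (iter_progression HR ob).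
Qed.

Lemma omul_graph a b y : ordinal a -> ordinal b -> is_set y -> (mul_graph a b y <-> y = omul a b).
Proof.
move=> oa ob sy.
have D : definable2 (fun x z : T => add_graph x a z) by definability.
have E (x z : T) : ordinal x -> is_set z -> (add_graph x a z <-> z = oadd x a).
  by move=> ox sz; apply: oadd_graph.
have O x : ordinal x -> ordinal (oadd x a) by move=> ox; apply: oadd_ordinal.
have [R HR] := progression_exists O D E ordinal_empty.
exact: (rel_iterates_iter O E ordinal_empty HR ob sy).
Qed.

Lemma omul_ordinal a b : ordinal a -> ordinal b -> ordinal (omul a b).
Proof.
move=> oa ob; have [R [[_ [_ [_ [oR _]]]] E]] := omul_progression oa.
by rewrite E //; apply: oR.
Qed.

(** The products [a * n] increase strictly because [a] is not zero, so an [x] below [a * n] has its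
    successor below [a * (n + 1)]. *)
Lemma omul_omega_limit a : ordinal a -> a <> empty -> is_limit (omul a omega).
Proof.
move=> oa a0; have ow := proj1 omega_limit; have [w0 wS] := omega_inductive.
split; first exact: omul_ordinal.
have [R [HR ->]] := omul_progression oa => //.
have [FR [_ [R0 [oR [RS _]]]]] := HR.
have K n : n \in omega -> app R n \in app R (succ n).
  by move=> no; have on := ordinal_mem ow no; rewrite RS //; apply: mem_oadd; auto.
split.
  move=> E; suff : app R empty \in app R omega by rewrite E => /in_empty.
  rewrite (progression_limit HR) //; first exact: omega_limit.
  by exists (succ empty); split; [apply: wS|apply: K].
move=> x; have L := omega_limit; rewrite !(progression_limit HR) //.
move=> [n [no xn]]; exists (succ n); split; first exact: wS.
have on := ordinal_mem ow no; have oRn := oR _ on.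
have /in_succ [_ [H|->]] := succ_le oRn xn; last exact: K.
by apply: ordinal_trans (K _ no) H; auto.
Qed.

Lemma oexp_omega_progression :
  exists R, progression (fun x : T => omul x omega) (succ empty) R /\
    forall b, ordinal b -> oexp omega b = app R b.
Proof.
have ow := proj1 omega_limit.
have D : definable2 (fun x z : T => mul_graph x omega z) by definability.
have E (x z : T) : ordinal x -> is_set z -> (mul_graph x omega z <-> z = omul x omega).
  by move=> ox sz; apply: omul_graph.
have O x : ordinal x -> ordinal (omul x omega) by move=> ox; apply: omul_ordinal.
have [R HR] := progression_exists O D E (ordinal_succ ordinal_empty).
exists R; split=> // b ob; exact: (iter_progression HR ob).
Qed.

Lemma oexp_omega_limit k : ordinal k -> k <> empty -> is_limit (oexp omega k).
Proof.
move=> ok k0; have [R [HR ->]] := oexp_omega_progression => //.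
have [FR [_ [R0 [oR [RS _]]]]] := HR.
have os := ordinal_succ ordinal_empty.
(* The power with exponent 0 is 1 and no limit, so closure under successor is claimed for
   [d <> empty] only; that the powers are nonzero is carried along for the successor step. *)
pose P d y := empty \in y /\ (d <> empty -> forall x, x \in y -> succ x \in y).
suff [Rk H] : P k (app R k).
  by split; [exact: oR|split; [move=> E; rewrite E in Rk; case: (in_empty Rk)|exact: H]].
apply: (progression_induction HR) => //; rewrite /P.
- by definability.
- by split; auto.
- move=> d od [Rd _]; have N : app R d <> empty by move=> E; rewrite E in Rd; case: (in_empty Rd).
  have [oM [M0 MS]] := omul_omega_limit (oR _ od) N.
  by split=> //; apply: empty_mem.
- move=> d L IH; have [od [d0 dS]] := L; have zd := empty_mem od d0.
  split; first by apply/(progression_limit HR) => //; exists empty; split=> //; case: (IH _ zd).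
  move=> _ x /(progression_limit HR _ L) [z [zd' xz]].
  (* An element found at exponent 0 is [empty]; its successor is looked for at exponent 1, where
     closure is available. *)
  apply/(progression_limit HR) => //; have [E|z0] := classic (z = empty).
    exists (succ empty); split; first exact: dS.
    move: xz; rewrite E R0 => /in_succ [_ [/in_empty //|->]].
    have [H1 H2] := IH _ (dS _ zd).
    by apply: H2 => //; apply: succ_neq_empty.
  by exists z; split=> //; apply: (proj2 (IH _ zd')).
Qed.

Lemma oexp_omega_shift k i : ordinal k -> k <> empty -> i \in oexp omega k ->
  oadd (succ (@empty T)) i \in oexp omega k.
Proof.
move=> ok k0 ik; have [ol [_ lS]] := oexp_omega_limit ok k0.
have oi := ordinal_mem ol ik.
have oa := oadd_ordinal (ordinal_succ ordinal_empty) oi.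
have [->|H] := ordinal_sub oa (ordinal_succ oi) (one_oadd_le oi); first exact: lS.
by apply: ordinal_trans H => //; apply: lS.
Qed.

(** * Self-similar skands *)

Lemma in_const l a p : p \in const l a <-> is_set p /\ exists i, i \in l /\ p = opair i a.
Proof. by rewrite /const (in_cls HT); first by definability. Qed.

Lemma opair_const l a i y : is_set i -> is_set y -> is_set a ->
  (opair i y \in const l a <-> i \in l /\ y = a).
Proof.
move=> si sy sa; rewrite in_const; split=> [[_ [j [jl E]]]|[il ->]].
  by have [-> ->] := opair_inj si sy (set_in _ _ jl) sa E.
by split; [exact: opair_set|exists i].
Qed.

Lemma const_fun l a : is_set a -> is_fun (const l a).
Proof.
move=> sa; split=> [p /in_const [_ [i [il ->]]]|i y z si sy sz].
  by exists i, a; split; first exact: set_in il.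
by rewrite !opair_const // => -[_ ->] [_ ->].
Qed.

Lemma dom_const l a : is_set a -> dom (const l a) = l.
Proof.
move=> sa; apply: subclass_eq => i; rewrite in_dom.
  by move=> [si [y [sy]]]; rewrite opair_const // => -[].
move=> il; have si := set_in _ _ il; split=> //.
by exists a; rewrite opair_const.
Qed.

Lemma app_const l a i : is_set a -> i \in l -> app (const l a) i = a.
Proof.
move=> sa il; have si := set_in _ _ il; apply: app_eq => //; first exact: const_fun.
by rewrite opair_const.
Qed.

Lemma skand_spec F : component_system F ->
  is_set F /\ is_set (skand F) /\ opair F (skand F) \in skands T.
Proof.
move=> CF; have D := ax_skand_dom _ HT _ CF; split; first exact: set_in D.
exact: app_spec (ax_skand_fun _ HT) D.
Qed.

Section SelfSimilar.

Variable k : T.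
Hypothesis k_ordinal : ordinal k.
Hypothesis k_ge1 : k <> empty.

Let l : T := oexp omega k.
Let self_similar a : T := skand (const l a).

Lemma empty_length : empty \in l.
Proof. by have [ol [l0 _]] := oexp_omega_limit k_ordinal k_ge1; apply: empty_mem. Qed.

Lemma const_system a : is_set a -> component_system (const l a).
Proof. by move=> sa; split; [exact: const_fun|exists k; rewrite dom_const]. Qed.

Lemma tail_const a : is_set a -> tail (const l a) = const l a.
Proof.
move=> sa.
have E p : (exists i, i \in l /\ p = opair i a) <-> (exists i, i \in dom (const l a) /\
    p = opair i (app (const l a) (oadd (succ empty) i))).
  by rewrite dom_const //; split=> -[i [il ->]]; exists i; split=> //;
    rewrite app_const //; apply: oexp_omega_shift.
apply: (ax_ext _ HT) => p; rewrite /tail (in_cls HT) ?in_const ?E //.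
by apply: (definable_iff _ _ _ _ E); definability.
Qed.

Lemma mem_self_similar a x : is_set a ->
  (x \in self_similar a <-> x \in a \/ x = self_similar a).
Proof.
move=> sa; rewrite /self_similar (ax_skand_mem _ HT _ (const_system sa)).
by rewrite app_const ?tail_const //; exact: empty_length.
Qed.

(** * The enumeration of the skands that represent ordinals *)

Definition index_class : T := cls (fun x => ordinal x /\ x <> empty).

Lemma in_index x : x \in index_class <-> ordinal x /\ x <> empty.
Proof.
rewrite /index_class (in_cls HT); first by definability.
by split=> [[]|[ox x0]] //; split=> //; auto.
Qed.

(** The recursion for all e^(a) at once, with the earlier skands collected as the range of a
    restriction. Unlike [e k], the class [E] can be a parameter of a formula. *)
Definition numbering E : Prop :=
  is_fun E /\ dom E = index_class /\
  forall a, a \in index_class -> app E a = self_similar (range (restrict E a)).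

Lemma numbering_exists : exists E, numbering E.
Proof.
(* [skands] is itself a class, so its pairs give a formula for forming the next skand from the
   history [g]. *)
have D : definable2 (fun g y => opair (const l (range g)) y \in skands T) by definability.
have [E [FE [dE HE]]] : exists E, is_fun E /\ dom E = index_class /\
    forall x, x \in index_class -> opair (restrict E x) (app E x) \in
      relation (fun g y => opair (const l (range g)) y \in skands T).
  apply: transfinite_recursion; first by move=> x /in_index [].
    apply: relation_fun => // g y z sg sy sz.
    have [_ FS] := ax_skand_fun _ HT; apply: FS => //.
    by have [] := skand_spec (const_system (range_set sg)).
  move=> g sg; have [sF [sS H]] := skand_spec (const_system (range_set sg)).
  by apply: (dom_pair sg sS); rewrite in_relation.
exists E; split=> //; split=> // a ia; have [oa a0] := proj1 (in_index a) ia.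
have sr : is_set (restrict E a) by apply: restrict_set; auto.
have [sF [sS H]] := skand_spec (const_system (range_set sr)).
have := HE a ia; have := ia; rewrite -dE => /(app_spec FE) [sE _].
rewrite in_relation // => K.
by have [_ FS] := ax_skand_fun _ HT; apply: FS K H.
Qed.

Section Numbering.

Variable E : T.
Hypothesis HE : numbering E.

Lemma numbering_spec a : ordinal a -> a <> empty -> is_set (app E a) /\ opair a (app E a) \in E.
Proof. by move=> oa a0; have [FE [dE _]] := HE; apply: app_spec; rewrite ?dE ?in_index. Qed.

Lemma in_initial a x : ordinal a -> (x \in range (restrict E a) <->
  exists b, b \in a /\ b <> empty /\ x = app E b).
Proof.
move=> oa; have [FE [dE _]] := HE; rewrite in_range; split.
  move=> [sx [b [sb]]]; rewrite opair_restrict // => -[ba H]; exists b; split=> //.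
  have := dom_pair sb sx H; rewrite dE in_index => -[_ b0]; split=> //.
  by rewrite (app_eq FE sb sx H).
move=> [b [ba [b0 ->]]]; have ob := ordinal_mem oa ba.
have [s H] := numbering_spec ob b0; split=> //.
by exists b; rewrite opair_restrict; auto.
Qed.

Lemma initial_set a : ordinal a -> is_set (range (restrict E a)).
Proof. by move=> oa; have [FE _] := HE; apply/range_set/restrict_set; auto. Qed.

Lemma initial_cls f a : ordinal a -> is_fun f -> (forall x, x \in a -> x <> empty -> x \in dom f) ->
  (forall x, x \in dom f -> x <> empty) ->
  cls (fun x => exists z, z \in a /\ z <> empty /\ x = app f z) = range (restrict f a).
Proof.
move=> oa Ff da df.
have H x : x \in range (restrict f a) <-> exists z, z \in a /\ z <> empty /\ x = app f z.
  rewrite in_range; split.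
    move=> [sx [z [sz]]]; rewrite opair_restrict // => -[za K]; exists z; split=> //.
    by split; [apply/df/(dom_pair sz sx K)|rewrite (app_eq Ff sz sx K)].
  move=> [z [za [z0 ->]]]; have [s K] := app_spec Ff (da _ za z0); split=> //.
  by have sz := set_in _ _ za; exists z; rewrite opair_restrict.
apply: (ax_ext _ HT) => x; rewrite (in_cls HT).
  by apply: (definable_iff _ _ _ _ H); definability.
by rewrite -H; split=> [[]|K] //; split=> //; apply: set_in K.
Qed.

(** A restriction of [E] shows that some [e_sequence] exists; the one chosen by [the] agrees with
    [E] by induction. *)
Lemma e_numbering a : ordinal a -> a <> empty -> e k a = app E a.
Proof.
move=> oa a0; have [FE [dE EE]] := HE; have osa := ordinal_succ oa.
have din x : x \in cls (fun x => x \in succ a /\ x <> empty) <-> x \in succ a /\ x <> empty.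
  rewrite (in_cls HT); first by definability.
  by split=> [[]|[H x0]] //; split=> //; apply: set_in H.
have : exists f, e_sequence l f a /\ e k a = app f a.
  rewrite /e /the; apply: (epsilon_spec _ (fun y => exists f, e_sequence l f a /\ y = app f a)).
  exists (app E a), (restrict E (succ a)).
  have Fr : is_fun (restrict E (succ a)) by apply: restrict_fun.
  have dr x : x \in dom (restrict E (succ a)) <-> x \in succ a /\ x <> empty.
    rewrite dom_restrict dE in_index; split=> [[[]]|[H x0]] //.
    by split=> //; split=> //; apply: ordinal_mem osa H.
  have er x : x \in succ a -> x <> empty -> app (restrict E (succ a)) x = app E x.
    move=> xa x0; apply: app_restrict => //; rewrite dE in_index; split=> //.
    exact: ordinal_mem osa xa.
  split; last by rewrite er; auto.
  split=> //; split; first by apply: (ax_ext _ HT) => x; rewrite din dr.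
  move=> b /dr [ba b0]; have ob := ordinal_mem osa ba.
  rewrite er // EE ?in_index // initial_cls //.
      by move=> x xb x0; apply/dr; split=> //; apply: ordinal_trans osa ba xb.
    by move=> x /dr [].
  congr (skand (const l (range _))); apply: fun_ext; [exact: restrict_fun|exact: restrict_fun|].
  move=> x y sx sy; rewrite !opair_restrict //.
  by split=> [[xb H]|[xb [_ H]]] //; do !split=> //; apply: ordinal_trans osa ba xb.
move=> [f [[Ff [df Hf]] ->]].
have dfE x : x \in dom f <-> x \in succ a /\ x <> empty by rewrite df din.
suff H : forall b, ordinal b -> b \in dom f ->
    exists y, is_set y /\ (opair b y \in E /\ opair b y \in f).
  have [|y [sy [H1 H2]]] := H a oa; first by rewrite dfE; auto.
  by rewrite (app_eq Ff _ sy H2) ?(app_eq FE _ sy H1); auto.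
apply: ordinal_induction; first by definability.
move=> b ob IH bf; have [ba b0] := proj1 (dfE b) bf.
have [s H] := numbering_spec ob b0; exists (app E b); split=> //; split=> //.
have -> : app E b = app f b; last by apply: (proj2 (app_spec Ff bf)).
have zf z : z \in b -> z <> empty -> z \in dom f.
  by move=> zb z0; apply/dfE; split=> //; apply: ordinal_trans osa ba zb.
rewrite Hf // EE ?in_index // initial_cls //; first by move=> z /dfE [].
congr (skand (const l (range _))); apply: fun_ext; [exact: restrict_fun|exact: restrict_fun|].
move=> z y sz sy; rewrite !opair_restrict //.
have IHz : z \in b -> z <> empty -> opair z (app E z) \in f.
  move=> zb z0; have [w [sw [K1 K2]]] := IH z zb (zf z zb z0).
  by rewrite (app_eq FE sz sw K1).
split=> -[zb K]; split=> //.
  have := dom_pair sz sy K; rewrite dE in_index => -[_ z0].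
  by rewrite -(app_eq FE sz sy K); apply: IHz.
have /dfE [_ z0] := dom_pair sz sy K.
have [sE H'] := numbering_spec (ordinal_mem ob zb) z0.
by case: Ff => _ Ff; rewrite (Ff z y (app E z)) //; apply: IHz.
Qed.

(** [ax_skand_eq] turns an equality of values into an equality of their components. The class [B] of
    indices whose value already occurs at a smaller index then has no least element. *)
Lemma numbering_injective a b : ordinal a -> ordinal b -> a <> empty -> b <> empty ->
  app E a = app E b -> a = b.
Proof.
have [FE [dE EE]] := HE.
pose B := cls (fun x => ordinal x /\ x <> empty /\ exists y, y \in x /\ exists z, is_set z /\
  (opair x z \in E /\ opair y z \in E)).
have inB x : x \in B <-> ordinal x /\ x <> empty /\
    exists y, y \in x /\ y <> empty /\ app E x = app E y.
  rewrite /B (in_cls HT); first by definability.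
  split=> [[sx [ox [x0 [y [yx [z [sz [xz yz]]]]]]]]|[ox [x0 [y [yx [y0 H]]]]]].
    do 2 split=> //; exists y; split=> //; have sy := set_in _ _ yx.
    have := dom_pair sy sz yz; rewrite dE in_index => -[_ y0]; split=> //.
    by rewrite (app_eq FE sx sz xz) (app_eq FE sy sz yz).
  split; first exact: ordinal_set.
  do 2 split=> //; exists y; split=> //; exists (app E x).
  have [s K] := numbering_spec ox x0; split=> //; split=> //.
  by rewrite H; apply: (proj2 (numbering_spec (ordinal_mem ox yx) y0)).
(* If [E x = E y] with [y] less than [x], then [E y] is among the components of
   [E x], hence of [E y]; so [y] has the same property. *)
have descent x : x \in B -> exists y, y \in x /\ y \in B.
  move=> /inB [ox [x0 [y [yx [y0 H]]]]]; have oy := ordinal_mem ox yx.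
  exists y; split=> //; apply/inB; do 2 split=> //.
  have : range (restrict E x) = range (restrict E y).
    apply: (ax_skand_eq _ HT k) => //; try exact: initial_set.
    by move: H; rewrite !EE ?in_index.
  move=> H'; have : app E y \in range (restrict E x) by apply/in_initial => //; exists y.
  by rewrite H' in_initial // => -[z [zy [z0 K]]]; exists z.
have emptyB : B = empty.
  have [//|nB] := empty_or B.
  have [m [mB least]] : exists m, m \in B /\ forall y, y \in B -> m = y \/ m \in y.
    by apply: ordinal_least => // x /inB [].
  have [y [ym yB]] := descent _ mB; have [om _] := proj1 (inB m) mB.
  case: (ordinal_irr om).
  by have [E'|my] := least _ yB; [rewrite {1}E'|apply: ordinal_trans om ym my].
move=> oa ob a0 b0 H; have [ab|[//|ba]] := ordinal_total oa ob.
  by case: (@in_empty b); rewrite -emptyB; apply/inB; do 2 split=> //; exists a.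
by case: (@in_empty a); rewrite -emptyB; apply/inB; do 2 split=> //; exists b.
Qed.

Lemma numbering_mem a b : ordinal a -> ordinal b -> a <> empty -> b <> empty ->
  (app E a \in app E b <-> a \in succ b).
Proof.
move=> oa ob a0 b0; have [FE [dE EE]] := HE.
have -> : app E b = self_similar (range (restrict E b)) by apply/EE/in_index.
rewrite mem_self_similar; first exact: initial_set.
rewrite -EE ?in_index // in_initial // in_succ.
split=> [[[z [zb [z0 H]]]|H]|[_ [ab|->]]]; auto.
- have -> : a = z by apply: numbering_injective => //; apply: ordinal_mem zb.
  by split; [apply: set_in zb|left].
- by split; auto; right; apply: numbering_injective.
- by left; exists a.
Qed.

Lemma e_system_numbering a : ordinal a -> e_system k a = const l (range (restrict E a)).
Proof.
move=> oa; congr const.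
have H x : x \in range (restrict E a) <-> exists c : T, c \in a /\ c <> empty /\ x = e k c.
  rewrite in_initial //; split=> -[z [za [z0 ->]]]; exists z; do 2 split=> //.
    by rewrite e_numbering //; apply: ordinal_mem za.
  by rewrite e_numbering //; apply: ordinal_mem za.
apply: (ax_ext _ HT) => x; rewrite (in_cls HT).
  by apply: (definable_iff _ _ _ _ H); definability.
by rewrite -H; split=> [[]|K] //; split=> //; apply: set_in K.
Qed.

Lemma in_Omega p : p \in Omega k <->
  exists i b, i \in l /\ ordinal b /\ b <> empty /\ p = opair i (app E b).
Proof.
have [FE [dE EE]] := HE.
have H q : (exists i, i \in l /\ exists b, is_set b /\ (ordinal b /\ b <> empty /\
      exists y, is_set y /\ (opair b y \in E /\ q = opair i y))) <->
    exists F i x, (exists a, ordinal a /\ a <> empty /\ F = e_system k a) /\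
      i \in dom F /\ x \in app F i /\ q = opair i x.
  split.
    move=> [i [il [b [sb [ob [b0 [y [sy [by' ->]]]]]]]]]; have os := ordinal_succ ob.
    (* The components of [e_system k a] hold only the numbers with index below [a], so e^(b) is
       found in the system of index [succ b]. *)
    exists (e_system k (succ b)), i, y; split.
      by exists (succ b); split=> //; split=> //; apply: succ_neq_empty.
    have sr := initial_set os.
    rewrite e_system_numbering // dom_const // app_const //; do 2 split=> //.
    rewrite in_initial //; exists b; split; auto; split=> //.
    by rewrite (app_eq FE sb sy by').
  move=> [F [i [x [[a [oa [a0 ->]]]]]]]; have sr := initial_set oa.
  rewrite e_system_numbering // dom_const // => -[il]; rewrite app_const //.
  rewrite in_initial // => -[[b [ba [b0 ->]]] ->]; have ob := ordinal_mem oa ba.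
  exists i; split=> //; exists b; split; auto; do 2 split=> //.
  by exists (app E b); have [] := numbering_spec ob b0.
rewrite /Omega /skand_union (in_cls HT).
  by apply: (definable_iff _ _ _ _ H); definability.
rewrite -H; split.
  move=> [_ [i [il [b [sb [ob [b0 [y [sy [by' ->]]]]]]]]]].
  by exists i, b; rewrite (app_eq FE sb sy by').
move=> [i [b [il [ob [b0 ->]]]]]; have [s K] := numbering_spec ob b0.
split; first by apply: opair_set => //; apply: set_in il.
by exists i; split=> //; exists b; split; auto; do 2 split=> //; exists (app E b).
Qed.

Lemma in_Omega_numbers x : x \in Omega_numbers k <->
  exists b, ordinal b /\ b <> empty /\ x = app E b.
Proof.
rewrite /Omega_numbers /component (in_cls HT); first by definability.
split.
  move=> [sx /in_Omega [i [b [il [ob [b0 H]]]]]]; exists b; do 2 split=> //.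
  have [s K] := numbering_spec ob b0.
  by have [_] := opair_inj empty_set sx (set_in _ _ il) s H.
move=> [b [ob [b0 ->]]]; have [s K] := numbering_spec ob b0; split=> //.
by apply/in_Omega; exists empty, b; split; first exact: empty_length.
Qed.

End Numbering.

End SelfSimilar.

(** * Equinumerosity *)

(* [bijects] without the description [app], so that it can be expressed by a
   formula. *)
Definition pairing F A B : Prop :=
  (forall x, is_set x -> forall y, is_set y -> opair x y \in F -> x \in A /\ y \in B) /\
  (forall x, x \in A -> exists y, is_set y /\ opair x y \in F) /\
  (forall y, y \in B -> exists x, is_set x /\ opair x y \in F) /\
  (forall x, is_set x -> forall y, is_set y -> forall z, is_set z ->
     opair x y \in F -> opair x z \in F -> y = z) /\
  (forall x, is_set x -> forall y, is_set y -> forall z, is_set z ->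
     opair x z \in F -> opair y z \in F -> x = y).

Lemma injects_pair F A B x y : injects F A B -> is_set x -> is_set y -> opair x y \in F ->
  x \in A /\ y \in B /\ y = app F x.
Proof.
move=> [[FF [dF H]] _] sx sy K; have xA := dom_pair sx sy K; rewrite dF in xA.
by rewrite -(app_eq FF sx sy K); split=> //; split=> //; apply: H.
Qed.

Lemma bijects_pairing F A B : bijects F A B -> pairing F A B.
Proof.
move=> [IF sur]; have [[FF [dF HF]] inj] := IF.
have P x : x \in A -> is_set (app F x) /\ opair x (app F x) \in F.
  by move=> xA; apply: app_spec; rewrite ?dF.
split; first by move=> x sx y sy K; have [? [? _]] := injects_pair IF sx sy K.
split; first by move=> x /P K; exists (app F x).
split; first by move=> y /sur [x [xA <-]]; exists x; split; [apply: set_in xA|case: (P x xA)].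
split; first by move=> x sx y sy z sz; case: FF => _; apply.
move=> x sx y sy z sz xz yz.
have [xA [_ Ex]] := injects_pair IF sx sz xz; have [yA [_ Ey]] := injects_pair IF sy sz yz.
by apply: inj => //; rewrite -Ex.
Qed.

Lemma pairing_bijects F A B : is_fun F -> pairing F A B -> bijects F A B.
Proof.
move=> FF [H [tot [sur [_ inj]]]].
have dF : dom F = A.
  apply: subclass_eq => x; first by move=> /in_dom [sx [y [sy /H]]] [].
  by move=> xA; rewrite in_dom; split; [apply: set_in xA|apply: tot].
have P x : x \in A -> is_set (app F x) /\ opair x (app F x) \in F.
  by move=> xA; apply: app_spec; rewrite ?dF.
split; first split.
- do 2 split=> //.
  by move=> x xA; have [s K] := P x xA; have [] := H _ (set_in _ _ xA) _ s K.
- move=> x y xA yA E; have [s K] := P x xA; have [s' K'] := P y yA.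
  by rewrite -E in K'; apply: inj K K' => //; [apply: set_in xA|apply: set_in yA].
- move=> y yB; have [x [sx K]] := sur y yB; have [xA _] := H _ sx _ (set_in _ _ yB) K.
  by exists x; split=> //; apply: app_eq => //; apply: set_in yB.
Qed.

Lemma equinumerous_relation (R : T -> T -> Prop) A B : definable2 R ->
  (forall x y, is_set x -> is_set y -> R x y -> x \in A /\ y \in B) ->
  (forall x, x \in A -> exists y, is_set y /\ R x y) ->
  (forall y, y \in B -> exists x, is_set x /\ R x y) ->
  (forall x y z, is_set x -> is_set y -> is_set z -> R x y -> R x z -> y = z) ->
  (forall x y z, is_set x -> is_set y -> is_set z -> R x z -> R y z -> x = y) ->
  exists F, is_fun F /\ pairing F A B.
Proof.
move=> DR H tot sur fn inj; exists (relation R); split; first exact: relation_fun.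
split; first by move=> x sx y sy; rewrite in_relation //; apply: H.
split.
  by move=> x xA; have [y [sy K]] := tot x xA; exists y; rewrite in_relation //; apply: set_in xA.
split.
  by move=> y yB; have [x [sx K]] := sur y yB; exists x; rewrite in_relation //; apply: set_in yB.
split; move=> x sx y sy z sz; rewrite !in_relation //; [exact: fn|exact: inj].
Qed.

(** A [pairing] may have elements that are not pairs; the relation formed by its pairs is a
    function. *)
Lemma equinumerousP A B : equinumerous A B <-> exists F, pairing F A B.
Proof.
split=> [[F /bijects_pairing]|[F PF]]; first by exists F.
have [H [tot [sur [fn inj]]]] := PF.
have [|x y sx sy K|//|//|x y z sx sy sz|x y z sx sy sz|G [FG PG]] :=
    @equinumerous_relation (fun x y => opair x y \in F) A B.
- by definability.
- exact: H K.
- by apply: fn.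
- by apply: inj.
- by exists G; apply: pairing_bijects.
Qed.

(** A bijection from a set is a set, so equinumerosity can be expressed by a set quantifier; the
    strong limit property needs this to form a class of ordinals. *)
Lemma equinumerous_set A B : is_set A ->
  (equinumerous A B <-> exists F, is_set F /\ pairing F A B).
Proof.
move=> sA; split=> [[F BF]|[F [_ PF]]]; last by apply/equinumerousP; exists F.
exists F; split; last exact: bijects_pairing.
by have [[[FF [dF _]] _] _] := BF; apply: fun_set => //; rewrite dF.
Qed.

Lemma equinumerous_trans A B C : equinumerous A B -> equinumerous B C -> equinumerous A C.
Proof.
move=> /equinumerousP [F [H [tot [sur [fn inj]]]]] /equinumerousP [G [H' [tot' [sur' [fn' inj']]]]].
have [|x y sx sy [z [sz [K K']]]|x xA|y yC|x y z sx sy sz|x y z sx sy sz|U [FU PU]] :=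
    @equinumerous_relation
      (fun x y => exists z, is_set z /\ (opair x z \in F /\ opair z y \in G)) A C.
- by definability.
- by have [? _] := H _ sx _ sz K; have [_ ?] := H' _ sz _ sy K'.
- have [z [sz K]] := tot x xA; have [_ zB] := H _ (set_in _ _ xA) _ sz K.
  by have [y [sy K']] := tot' z zB; exists y; split=> //; exists z.
- have [z [sz K]] := sur' y yC; have [zB _] := H' _ sz _ (set_in _ _ yC) K.
  by have [x [sx K']] := sur z zB; exists x; split=> //; exists z.
- move=> [u [su [K1 K2]]] [v [sv [K3 K4]]].
  by rewrite (fn x sx u su v sv K1 K3) in K2; apply: fn' K2 K4.
- move=> [u [su [K1 K2]]] [v [sv [K3 K4]]].
  by rewrite (inj' u su v sv z sz K2 K4) in K1; apply: inj K1 K3.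
- by apply/equinumerousP; exists U.
Qed.

(** Replacement for the inverse function. *)
Lemma injects_set F A B : injects F A B -> is_set B -> is_set A.
Proof.
move=> IF sB; have [[FF [dF _]] inj] := IF.
have D : definable2 (fun y x => opair x y \in F) by definability.
have FI : is_fun (relation (fun y x => opair x y \in F)).
  apply: relation_fun => // z x y sz sx sy xz yz.
  have [xA [_ Ex]] := injects_pair IF sx sz xz; have [yA [_ Ey]] := injects_pair IF sy sz yz.
  by apply: inj => //; rewrite -Ex.
apply: separation (ax_replacement _ HT _ _ FI sB) _ => x xA; have sx := set_in _ _ xA.
have [|s K] := @app_spec F x FF; first by rewrite dF.
rewrite in_image; split=> //; exists (app F x); rewrite in_relation //; split=> //.
by have [_ []] := injects_pair IF sx s K.
Qed.

Lemma equinumerous_is_set A B : equinumerous A B -> is_set B -> is_set A.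
Proof. by move=> [F [IF _]]; apply: injects_set IF. Qed.

(* The Mostowski collapse of [A]: an element is sent to the least nonempty
   ordinal that is not a value at a smaller element. *)
Lemma ordinals_collapse A : is_set A -> (forall x, x \in A -> ordinal x) ->
  exists b, ordinal b /\ b <> empty /\ equinumerous A (cls (fun x => x \in b /\ x <> empty)).
Proof.
move=> sA oA.
(* Zero is skipped to match the numbering, which starts with e^(1). *)
pose free g y := ordinal y /\ (y <> empty /\ ~ y \in range g).
pose least g y := free g y /\ forall z, z \in y -> z <> empty -> z \in range g.
have Dl : definable2 least by rewrite /least /free; definability.
have least_unique g y z : least g y -> least g z -> y = z.
  move=> [[oy [y0 yg]] Hy] [[oz [z0 zg]] Hz].
  have [yz|[//|zy]] := ordinal_total oy oz; first by case: yg; apply: Hz.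
  by case: zg; apply: Hy.
have least_exists g : is_set (range g) -> exists y, least g y.
  move=> sg; pose B := cls (free g).
  have inB y : y \in B <-> free g y.
    rewrite /B /free (in_cls HT); first by definability.
    by split=> [[]|[oy H]] //; split=> //; auto.
  (* [g] is an arbitrary set, so only the ordinals in its range are bounded; the successor of a
     bound is then nonzero and free. *)
  have [b [ob gb]] : exists b, ordinal b /\ subclass (cls (fun x => x \in range g /\ ordinal x)) b.
    have inC x : x \in cls (fun x => x \in range g /\ ordinal x) <-> x \in range g /\ ordinal x.
      rewrite (in_cls HT); first by definability.
      by split=> [[]|[xg ox]] //; split=> //; auto.
    by apply: ordinal_bound; [apply: separation sg _|] => x /inC [].
  have os := ordinal_succ ob.
  have [m [/inB mB Hm]] : exists m, m \in B /\ forall y, y \in B -> m = y \/ m \in y.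
    apply: ordinal_least; first by move=> x /inB [].
    exists (succ b); apply/inB; split=> //; split; first by apply: succ_neq_empty; auto.
    move=> K; have : succ b \in b.
      by apply: gb; rewrite (in_cls HT); [definability|auto].
    by move=> K'; apply: (ordinal_irr ob); apply: ordinal_trans K' _; auto.
  exists m; split=> // z zm z0; have [//|N] := classic (z \in range g).
  have [om _] := mB; have oz := ordinal_mem om zm.
  have [E|mz] := Hm z (proj2 (inB z) (conj oz (conj z0 N))).
    by rewrite -E in zm; case: (ordinal_irr om).
  by case: (ordinal_irr om); apply: ordinal_trans zm mz.
have [R [FR [dR HR]]] : exists R, is_fun R /\ dom R = A /\
    forall x, x \in A -> opair (restrict R x) (app R x) \in relation least.
  apply: transfinite_recursion => //.
    by apply: relation_fun => // g y z _ _ _; apply: least_unique.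
  move=> g sg; have [y Hy] := least_exists _ (range_set sg).
  have sy : is_set y by have [[oy _] _] := Hy; auto.
  by apply: (dom_pair sg sy); rewrite in_relation.
have pR x : x \in A -> is_set (app R x) /\ opair x (app R x) \in R.
  by move=> xA; apply: app_spec; rewrite ?dR.
have {}HR x : x \in A -> least (restrict R x) (app R x).
  move=> xA; have [s _] := pR x xA; have := HR x xA; rewrite in_relation //.
  by apply: restrict_set => //; apply/ordinal_set/oA.
have sR : is_set R by apply: fun_set; rewrite ?dR.
have mono x y : x \in A -> y \in A -> x \in y -> app R x <> app R y.
  move=> xA yA xy E; have [[_ [_ N]] _] := HR y yA; apply: N; rewrite -E.
  have [s K] := pR x xA; rewrite in_range; split=> //; have sx := set_in _ _ xA.
  by exists x; rewrite opair_restrict.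
have inR y : y \in range R <-> exists x, x \in A /\ y = app R x.
  rewrite in_range; split=> [[sy [x [sx K]]]|[x [xA ->]]].
    by exists x; rewrite -dR (app_eq FR sx sy K); split=> //; apply: dom_pair K.
  by have [s K] := pR x xA; split=> //; exists x; split=> //; apply: set_in xA.
have down y z : y \in range R -> z \in y -> z <> empty -> z \in range R.
  move=> /inR [x [xA ->]] zy z0; have [_ H] := HR x xA.
  have := H z zy z0; rewrite !in_range => -[sz [w [sw]]]; rewrite opair_restrict // => -[_ K].
  by split=> //; exists w.
(* The first free ordinal for the whole of [R]: as the range is closed downwards by [down], it
   consists of exactly the nonzero elements of [b]. *)
have [b [[ob [b0 bR]] Hb]] := least_exists _ (range_set sR).
exists b; do 2 split=> //.
have inb y : y \in cls (fun x => x \in b /\ x <> empty) <-> y \in b /\ y <> empty.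
  rewrite (in_cls HT); first by definability.
  by split=> [[]|[yb y0]] //; split=> //; apply: set_in yb.
have -> : cls (fun x => x \in b /\ x <> empty) = range R.
  apply: subclass_eq => y; rewrite inb; first by case; apply: Hb.
  move=> yR; have [x [xA Ey]] := proj1 (inR y) yR.
  have [[oy [y0 _]] _] := HR x xA; rewrite -Ey in oy y0; split=> //.
  have [//|[E|by']] := ordinal_total oy ob; first by rewrite E in yR.
  by case: bR; apply: down yR by' b0.
apply/equinumerousP; exists R.
split.
  by move=> x sx y sy K; rewrite -dR in_range; split; [apply: dom_pair K|split=> //; exists x].
split; first by move=> x /pR K; exists (app R x).
split; first by move=> y /inR [x [xA ->]]; exists x; split; [apply: set_in xA|case: (pR x xA)].
split; first by move=> x sx y sy z sz; case: FR => _; apply.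
move=> x sx y sy z sz xz yz.
have xA : x \in A by rewrite -dR; apply: dom_pair xz.
have yA : y \in A by rewrite -dR; apply: dom_pair yz.
have E : app R x = app R y by rewrite (app_eq FR sx sz xz) (app_eq FR sy sz yz).
have [xy|[//|yx]] := ordinal_total (oA _ xA) (oA _ yA).
  by case: (mono x y).
by case: (mono y x).
Qed.

Lemma set_equinumerous_ordinal A : is_set A ->
  exists b, ordinal b /\ b <> empty /\ equinumerous A (cls (fun x => x \in b /\ x <> empty)).
Proof.
move=> sA; have [G BG] := ax_von_neumann _ HT.
have [H [tot [_ [fn inj]]]] := bijects_pairing BG; have [[[FG _] _] _] := BG.
have oI x : x \in image G A -> ordinal x.
  move=> /in_image [sx [y [yA K]]]; have [_] := H _ (set_in _ _ yA) _ sx K.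
  by rewrite in_On.
have [b [ob [b0 Eb]]] := ordinals_collapse (ax_replacement _ HT _ _ FG sA) oI.
exists b; do 2 split=> //; apply: equinumerous_trans Eb; apply/equinumerousP.
have [|x y sx sy [xA K]|x xA|y|x y z sx sy sz [_ K] [_ K']|x y z sx sy sz [_ K] [_ K']|F [_ PF]] :=
    @equinumerous_relation (fun x y => x \in A /\ opair x y \in G) A (image G A).
- by definability.
- by rewrite in_image; split=> //; split=> //; exists x.
- have [|y [sy K]] := tot x; first by rewrite in_univ; apply: set_in xA.
  by exists y.
- by rewrite in_image => -[sy [x [xA K]]]; exists x; split; first exact: set_in xA.
- exact: fn K K'.
- exact: inj K K'.
- by exists F.
Qed.

(** * The eschaton *)

Section Eschaton.

Variables k E : T.
Hypothesis k_ordinal : ordinal k.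
Hypothesis k_ge1 : k <> empty.
Hypothesis HE : numbering k E.

Let numbers : T := Omega_numbers k.

Lemma in_numbers x : x \in numbers <-> exists b, ordinal b /\ b <> empty /\ x = app E b.
Proof. exact: (in_Omega_numbers k_ordinal k_ge1 HE). Qed.

Lemma app_in_numbers b : ordinal b -> b <> empty -> app E b \in numbers.
Proof. by move=> ob b0; apply/in_numbers; exists b. Qed.

Lemma numbering_lt a b : ordinal a -> ordinal b -> a <> empty -> b <> empty ->
  (num_lt (app E a) (app E b) <-> a \in b).
Proof.
move=> oa ob a0 b0; rewrite /num_lt (numbering_mem k_ordinal k_ge1 HE) // in_succ.
split=> [[[_ [//|->]] []]|ab] //; split; first by split; [apply: set_in ab|left].
move=> /(numbering_injective k_ordinal k_ge1 HE oa ob a0 b0) H.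
by rewrite H in ab; case: (ordinal_irr ob).
Qed.

(** Moves questions about subclasses of Omega to their indices: least indices give least elements,
    and the indices of a set form a set by replacement for the inverse of [E], hence are bounded. *)
Lemma preimage_ordinals I : subclass I numbers ->
  exists J, (forall b, b \in J <-> ordinal b /\ b <> empty /\ app E b \in I) /\
            (is_set I -> is_set J).
Proof.
move=> IN; have [FE [dE _]] := HE.
have D : definable2 (fun y x => opair x y \in E) by definability.
have F : is_fun (relation (fun y x => opair x y \in E)).
  apply: relation_fun => // z x y sz sx sy xz yz.
  have := dom_pair sx sz xz; rewrite dE in_index => -[ox x0].
  have := dom_pair sy sz yz; rewrite dE in_index => -[oy y0].
  apply: (numbering_injective k_ordinal k_ge1 HE) => //.
  by rewrite (app_eq FE sx sz xz) (app_eq FE sy sz yz).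
exists (image (relation (fun y x => opair x y \in E)) I); split; last exact: ax_replacement.
move=> b; rewrite in_image; split.
  move=> [sb [y [yI]]]; have sy := set_in _ _ yI; rewrite in_relation // => K.
  have := dom_pair sb sy K; rewrite dE in_index => -[ob b0].
  by rewrite (app_eq FE sb sy K).
move=> [ob [b0 H]]; split; first exact: ordinal_set.
have [s K] := numbering_spec HE ob b0.
by exists (app E b); split=> //; rewrite in_relation //; auto.
Qed.

Lemma numbers_not_set : ~ is_set numbers.
Proof.
move=> sN; have [J [inJ sJ]] := @preimage_ordinals numbers (fun _ => id).
have [b [ob Jb]] : exists b, ordinal b /\ subclass J b.
  by apply: ordinal_bound; [exact: sJ|move=> x /inJ []].
have os := ordinal_succ ob; have s0 := succ_neq_empty (ordinal_set ob).
have K : succ b \in b by apply/Jb/inJ; do 2 split=> //; apply: app_in_numbers.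
by apply: (ordinal_irr ob); apply: ordinal_trans K _; auto.
Qed.

Lemma numbers_well_ordered : well_ordered num_lt numbers.
Proof.
split; first by move=> x _ [].
split.
  move=> x y z /in_numbers [a [oa [a0 ->]]] /in_numbers [b [ob [b0 ->]]]
    /in_numbers [d [od [d0 ->]]].
  by rewrite !numbering_lt // => ab bd; apply: ordinal_trans bd ab.
split.
  move=> x y /in_numbers [a [oa [a0 ->]]] /in_numbers [b [ob [b0 ->]]].
  by rewrite !numbering_lt //; have [|[->|]] := ordinal_total oa ob; auto.
move=> B BN [x xB]; have [J [inJ _]] := preimage_ordinals BN.
have num y : y \in B -> exists b, b \in J /\ y = app E b.
  move=> yB; have [b [ob [b0 H]]] := proj1 (in_numbers y) (BN _ yB).
  by exists b; split=> //; apply/inJ; rewrite -H.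
have [m [mJ least]] : exists m, m \in J /\ forall y, y \in J -> m = y \/ m \in y.
  apply: ordinal_least; first by move=> y /inJ [].
  by have [b [bJ _]] := num x xB; exists b.
have [om [m0 mB]] := proj1 (inJ m) mJ.
exists (app E m); split=> // y /num [b [bJ ->]]; have [ob [b0 _]] := proj1 (inJ b) bJ.
by have [->|mb] := least b bJ; [left|right; apply/numbering_lt].
Qed.

Lemma in_seg x a : x \in seg num_lt numbers a <-> x \in numbers /\ num_lt x a.
Proof.
rewrite /seg (in_cls HT); first by rewrite /num_lt; definability.
by split=> [[]|[xN xa]] //; split=> //; apply: set_in xN.
Qed.

Lemma seg_image b : ordinal b -> b <> empty -> seg num_lt numbers (app E b) = image E b.
Proof.
move=> ob b0; have [FE [dE _]] := HE; apply: (ax_ext _ HT) => x; rewrite in_seg in_image; split.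
  move=> [/in_numbers [a [oa [a0 ->]]]]; rewrite numbering_lt // => ab.
  by have [s K] := numbering_spec HE oa a0; split=> //; exists a.
move=> [sx [a [ab K]]]; have sa := set_in _ _ ab.
have := dom_pair sa sx K; rewrite dE in_index => -[oa a0].
by rewrite -(app_eq FE sa sx K); split; [exact: app_in_numbers|apply/numbering_lt].
Qed.

Lemma seg_set a : a \in numbers -> is_set (seg num_lt numbers a).
Proof.
move=> /in_numbers [b [ob [b0 ->]]]; rewrite seg_image //.
by have [FE _] := HE; apply: (ax_replacement _ HT) => //; auto.
Qed.

Lemma numbers_class_cardinal : class_cardinal num_lt numbers.
Proof.
split; last by split; [exact: numbers_not_set|exact: seg_set].
split; first exact: numbers_well_ordered.
move=> a aN H; apply: numbers_not_set; exact: equinumerous_is_set H (seg_set aN).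
Qed.

Lemma numbers_regular : regular num_lt numbers.
Proof.
move=> a F aN [FF [dF HF]] cof.
have IN : subclass (image F (seg num_lt numbers a)) numbers.
  move=> y; rewrite in_image => -[sy [x [xs K]]].
  by rewrite -(app_eq FF (set_in _ _ xs) sy K); apply: HF.
have [J [inJ sJ]] := preimage_ordinals IN.
have [b [ob Jb]] : exists b, ordinal b /\ subclass J b.
  apply: ordinal_bound; last by move=> x /inJ [].
  by apply/sJ/(ax_replacement _ HT) => //; apply: seg_set.
have os := ordinal_succ ob; have s0 := succ_neq_empty (ordinal_set ob).
(* All indices of the image lie in [b], so the number of index [succ b] exceeds the image; [succ b]
   is an index even if [b] is empty. *)
have [y [yI H]] := cof _ (app_in_numbers os s0).
have [d [od [d0 Ey]]] := proj1 (in_numbers y) (IN _ yI).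
have db : d \in b by apply/Jb/inJ; rewrite -Ey.
have : d \in succ b by auto.
case: H => [|]; rewrite Ey.
  move=> /(numbering_injective k_ordinal k_ge1 HE os od s0 d0) -> dd.
  exact: (ordinal_irr od).
by rewrite numbering_lt // => bd dd; apply: (ordinal_irr os); apply: ordinal_trans dd bd.
Qed.

Lemma seg_seg b x : ordinal b -> b <> empty -> x \in seg num_lt numbers (app E b) ->
  seg num_lt (seg num_lt numbers (app E b)) x = seg num_lt numbers x.
Proof.
move=> ob b0 /in_seg [xN xb]; have [_ [trans _]] := numbers_well_ordered.
apply: (ax_ext _ HT) => y; rewrite in_seg {1}/seg (in_cls HT).
  by rewrite /num_lt; definability.
rewrite in_seg; split=> [[_ [[yN _] yx]]|[yN yx]] //; split; first exact: set_in yN.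
by do 2 split=> //; apply: trans xb => //; apply: app_in_numbers.
Qed.

Lemma seg_well_ordered a : well_ordered num_lt (seg num_lt numbers a).
Proof.
have [irr [trans [tot wf]]] := numbers_well_ordered.
have S x : x \in seg num_lt numbers a -> x \in numbers by move=> /in_seg [].
split; first by move=> x /S; apply: irr.
split; first by move=> x y z /S xN /S yN /S zN; apply: trans.
split; first by move=> x y /S xN /S yN; apply: tot.
by move=> B BS; apply: wf => x /BS /S.
Qed.

Lemma set_equinumerous_seg A : is_set A ->
  exists b, ordinal b /\ b <> empty /\ equinumerous A (image E b).
Proof.
move=> sA; have [b [ob [b0 Eb]]] := set_equinumerous_ordinal sA.
have [FE [dE _]] := HE.
exists b; do 2 split=> //; apply: equinumerous_trans Eb _; apply/equinumerousP.
have inb y : y \in cls (fun x => x \in b /\ x <> empty) <-> y \in b /\ y <> empty.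
  rewrite (in_cls HT); first by definability.
  by split=> [[]|[yb y0]] //; split=> //; apply: set_in yb.
have [|x y sx sy [xb K]|x|y|x y z sx sy sz [_ K] [_ K']|x y z sx sy sz [xb K] [yb K']|F [_ PF]] :=
    @equinumerous_relation (fun x y => x \in b /\ opair x y \in E)
      (cls (fun x => x \in b /\ x <> empty)) (image E b).
- by definability.
- rewrite inb in_image; have := dom_pair sx sy K; rewrite dE in_index => -[_ x0].
  by do !split=> //; exists x.
- rewrite inb => -[xb x0]; have [s K] := numbering_spec HE (ordinal_mem ob xb) x0.
  by exists (app E x).
- by rewrite in_image => -[sy [x [xb K]]]; exists x; split; first exact: set_in xb.
- by case: FE => _ FE; apply: FE K K'.
- have := dom_pair sx sz K; rewrite dE in_index => -[ox x0].
  have := dom_pair sy sz K'; rewrite dE in_index => -[oy y0].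
  apply: (numbering_injective k_ordinal k_ge1 HE) => //.
  by rewrite (app_eq FE sx sz K) (app_eq FE sy sz K').
- by exists F.
Qed.

Lemma numbers_strong_limit : strong_limit num_lt numbers.
Proof.
move=> a [aN _]; set A := power (seg num_lt numbers a).
have sA : is_set A by apply/(ax_power _ HT)/seg_set.
pose B := cls (fun b => ordinal b /\ b <> empty /\ exists F, is_set F /\ pairing F A (image E b)).
have inB b : b \in B <-> ordinal b /\ b <> empty /\ equinumerous A (image E b).
  rewrite /B (in_cls HT); first by rewrite /pairing; definability.
  rewrite -equinumerous_set //.
  by split=> [[]|[ob H]] //; split; [exact: ordinal_set|split].
have [m [/inB [om [m0 Em]] least]] : exists m, m \in B /\ forall y, y \in B -> m = y \/ m \in y.
  apply: ordinal_least; first by move=> x /inB [].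
  by have [b Hb] := set_equinumerous_seg sA; exists b; apply/inB.
exists (app E m); rewrite seg_image //; split; last by [].
split; first exact: app_in_numbers.
split; first exact: seg_well_ordered.
(* A bijection onto the smaller segment below [x] would, composed with [Em], put the index of [x]
   into [B], against the minimality of [m]. *)
move=> x xs H; rewrite seg_seg // in H.
have [/in_numbers [d [od [d0 Ex]]]] := proj1 (in_seg x (app E m)) xs.
rewrite Ex numbering_lt // => dm.
have dB : d \in B.
  apply/inB; do 2 split=> //; apply: equinumerous_trans Em _.
  by rewrite -!seg_image // -Ex.
have [E'|md] := least d dB; first by rewrite -E' in dm; case: (ordinal_irr om).
by case: (ordinal_irr om); apply: ordinal_trans dm md.
Qed.

Lemma numbers_uncountable : uncountable numbers.
Proof. by move=> [F IF]; apply: numbers_not_set; apply: injects_set IF omega_set. Qed.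

Lemma Omega_not_set : ~ is_set (Omega k).
Proof.
move=> sO; apply: numbers_not_set; apply: (@separation _ (union (union (Omega k)))).
  by do !apply: (ax_union _ HT).
move=> x /in_numbers [b [ob [b0 ->]]]; have [s _] := numbering_spec HE ob b0.
(* The numbers are second coordinates of pairs in [Omega k] with index 0, so two unions reach
   them. *)
apply: (@opair_union_r _ empty) => //.
rewrite (in_Omega HE); exists empty, b; split=> //.
exact: empty_length.
Qed.

End Eschaton.

End Sets.

Unset Implicit Arguments.
Set Strict Implicit.

Theorem proposition15 (T : class_language) (HT : NBG_skand T)
    (k : T) (k_ordinal : ordinal k) (k_ge1 : k <> empty) :
  class_cardinal num_lt (Omega_numbers k) /\
  strongly_inaccessible num_lt (Omega_numbers k) /\
  ~ is_set (Omega k) /\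
  ~ set_cardinal (Omega_numbers k).
Proof.
have [E HE] := numbering_exists HT k_ordinal k_ge1.
split; first exact: numbers_class_cardinal HE.
split.
  split; first exact: numbers_uncountable HE.
  by split; [exact: numbers_regular HE|exact: numbers_strong_limit HE].
split; first exact: Omega_not_set HE.
move=> [x [sx H]]; apply: (numbers_not_set HT k_ordinal k_ge1 HE).
exact: equinumerous_is_set H sx.
Qed.
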